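(* Let $T>0$, let $N$ be a positive even integer, and suppose that $f\in\mathcal{A}_{T,\beta}$ for some $\beta>0$. Then the $T$-periodic Fourier interpolant $I_Nf$ satisfies $$\|f-I_Nf\| = O\left(e^{-\omega_{N\beta/2}}\right)\quad\text{as } N\to\infty .$$ Moreover, if $f$ is $\beta$-analytic, then $$\|f-I_Nf\| = 0 .$$
   Context: Notation: $\|\cdot\|$ is the $L^2([0,T])$ norm. $\omega_\alpha=\frac{2\pi\alpha}{T}$ for every real $\alpha$; thus $\omega_k=2\pi k/T$ and $\omega_{N\beta/2}=\pi N\beta/T$. Fourier interpolant: with nodes $x_j=Tj/N$, $j=0,\dots,N-1$, $I_Nf(x)=\sum_{k=-N/2}^{N/2-1}\tilde f_k e^{i\omega_k x}$, where $\tilde f_k=\frac1N\sum_{j=0}^{N-1}f(x_j)e^{-i\omega_k x_j}$ (the term $k=N/2$ is omitted); it satisfies $I_Nf(x_j)=f(x_j)$ for all $j$. For $\beta>0$, $\mathbf{C}_{T,\beta}=\{x+iy: x\in[0,T],\ y\in[-\beta,\beta]\}\subset\mathbb{C}$, and $\mathbf{C}_{T,\infty}=\{x+iy: x\in[0,T],\ y\in\mathbb{R}\}$. For $s\in\mathbb{Z}_{\ge 0}$, $\mathcal{H}_T^s$ is the set of $u$ in the Sobolev space $H^s([0,T])$ (derivatives up to order $s$ in $L^2$) such that $u^{(s)}$ is of bounded variation on $[0,T]$ and $u^{(j)}(0)=u^{(j)}(T)$ for $j=0,\dots,s-1$; $\mathcal{H}_T^\infty$ is the set of functions belonging to $\mathcal{H}_T^s$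 for all $s$ (in particular $u^{(j)}(0)=u^{(j)}(T)$ for all $j\ge0$). Functions are allowed to be complex-valued. $\mathcal{A}_{T,\beta}=\{u\in\mathcal{H}_T^\infty: u \text{ is analytic in some open set containing } \mathbf{C}_{T,\beta}\}$, with norm $\|u\|_{\mathcal{A}_{T,\beta}}=\|u\|_{L^\infty(\mathbf{C}_{T,\beta})}$. A function $u\in\mathcal{A}_{T,\beta}$ is called $\beta$-analytic if $u$ is analytic on $\mathbf{C}_{T,\infty}$ and $\lim_{\beta\to\infty}\frac{\|u\|_{\mathcal{A}_{T,\beta}}}{e^{\omega_\beta}}=0$ (in the limit, $\beta$ is a dummy variable tending to infinity). *)

(* Defs.v *)
From HB Require Import structures.
From mathcomp Require Import all_boot all_order all_algebra.
From mathcomp Require Import complex.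
From mathcomp Require Import all_classical all_reals all_analysis.

Set Implicit Arguments.
Unset Strict Implicit.
Unset Printing Implicit Defensive.

Import Order.TTheory GRing.Theory Num.Theory.
Import numFieldNormedType.Exports.

Local Open Scope classical_set_scope.
Local Open Scope ring_scope.
Local Open Scope complex_scope.

Section Fourier.
Context {R : realType}.
Implicit Types (T beta alpha t x : R) (N : nat).

Definition omega T alpha : R := 2 * pi * alpha / T.

(* exp (i t) *)
Definition expi t : R[i] := cos t +i* sin t.

Definition node T N (j : nat) : R := T * j%:R / N%:R.

(* The i-th frequency, for i = 0, ..., N - 1, is k = i - N / 2 (N is even). *)
Definition freq N (i : nat) : R := i%:R - (N./2)%:R.

Definition dft T N (u : R -> R[i]) (k : R) : R[i] :=
  (N%:R)^-1 *
  \sum_(j < N) u (node T N j) * expi (- (omega T k * node T N j)).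

Definition fourier_interp T N (u : R -> R[i]) x : R[i] :=
  \sum_(i < N) dft T N u (freq N i) * expi (omega T (freq N i) * x).

Definition L2norm T (u : R -> R[i]) : \bar R :=
  let v : R -> R := (fun x => Normc.normc (u x)) \_ `[0, T] in
  'N[lebesgue_measure]_2%:E [EFin \o v]%E.

End Fourier.

Section PeriodicSobolev.
Context {R : realType}.
Implicit Types (T : R) (s : nat) (phi g h u : R -> R).

(* phi is C^1 with (compact) support inside ]0, T[ *)
Definition test_function T phi : Prop :=
  [/\ forall x, derivable phi x 1,
      continuous (derive1 phi)
    & closure [set x | phi x != 0] `<=` `]0, T[].

Definition weak_derivative T g h : Prop := forall phi, test_function T phi ->
  (\int[lebesgue_measure]_(x in `[0%R, T]) (g x * derive1 phi x) =
   - \int[lebesgue_measure]_(x in `[0%R, T]) (h x * phi x))%R.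

(* g j is the representative of the j-th weak derivative of u; for j < s the
   derivative has a continuous one, which gives its boundary values a meaning. *)
Definition periodic_sobolev_real T s u : Prop :=
  exists g : nat -> R -> R,
    [/\ {in `[0, T], g 0%N =1 u},
        forall j, (j <= s)%N -> (g j) \_ `[0, T] \in Lfun lebesgue_measure 2%:E,
        forall j, (j < s)%N -> weak_derivative T (g j) (g j.+1),
        forall j, (j < s)%N ->
          {within `[0, T], continuous (g j)} /\ g j 0 = g j T
      & bounded_variation 0 T (g s)].

Definition periodic_sobolev T s (u : R -> R[i]) : Prop :=
  periodic_sobolev_real T s (fun x => complex.Re (u x)) /\
  periodic_sobolev_real T s (fun x => complex.Im (u x)).

Definition periodic_sobolev_oo T (u : R -> R[i]) : Prop :=
  forall s, periodic_sobolev T s u.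

End PeriodicSobolev.

Section Analytic.
Context {R : realType}.
Implicit Types (T b beta : R) (f : R[i] -> R[i]) (K : set R[i]).

Definition analytic_at f (z : R[i]) : Prop :=
  exists a : nat -> R[i], \forall w \near (z : R[i]^o),
    series (fun n => a n * (w - z) ^+ n : R[i]^o) @ \oo --> (f w : R[i]^o).

Definition analytic_near f K : Prop :=
  exists U : set R[i]^o,
    [/\ open U, K `<=` U & forall z, U z -> analytic_at f z].

Definition rect T b : set R[i] :=
  [set z | 0 <= complex.Re z <= T /\ - b <= complex.Im z <= b].

Definition strip T : set R[i] := [set z | 0 <= complex.Re z <= T].

(* An element of A_{T,beta} is represented by its (unique) analytic extension
   f : C -> C, the function on [0, T] being its restriction to the real axis. *)
Definition spaceA T beta f : Prop :=
  periodic_sobolev_oo T (fun x => f x%:C) /\ analytic_near f (rect T beta).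

Definition normA T b f : \bar R :=
  let v : R * R -> R := (fun p => Normc.normc (f (p.1 +i* p.2)))
      \_ [set p | rect T b (p.1 +i* p.2)] in
  'N[lebesgue_measure \x lebesgue_measure]_+oo%E [EFin \o v]%E.

Definition beta_analytic T beta f : Prop :=
  [/\ spaceA T beta f,
      analytic_near f (strip T)
    & (normA T b f / (expR (omega T b))%:E)%E @[b --> +oo%R] --> 0%E].

End Analytic.

(* Main.v *)
Require Import Defs.
From mathcomp Require Import all_boot all_order all_algebra.
From mathcomp Require Import complex.
From mathcomp Require Import all_classical all_reals all_analysis.
From mathcomp Require Import ess_sup_inf.
From mathcomp Require Import ring lra zify.

Import Order.TTheory GRing.Theory Num.Theory.
Import numFieldNormedType.Exports.

Set Implicit Arguments.
Unset Strict Implicit.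
Unset Printing Implicit Defensive.

Local Open Scope classical_set_scope.
Local Open Scope ring_scope.
Local Open Scope complex_scope.

(* Discrete proof, without contour integrals or Fourier series.  Let c^M_k be the
   k-th discrete Fourier coefficient of f on the grid of M = N n nodes.  On that
   grid f is exactly the sum of the c^M_k exp (i omega_k x), and I_N replaces each
   frequency by its alias in the band, so that the error at a grid point is at
   most 2 times the sum of the |c^M_k| over |k| >= N / 2.
   - For fixed k, the Riemann sum of f (z) exp (- i omega_k z) over the grid moves
     by O(1/M) when the grid is shifted to height b or - b: the complex derivative turns
     the vertical increment into a horizontal one, and horizontal increments
     telescope to 0 because f (i y) = f (T + i y).  Hence |c^M_k| is bounded by
     sup |f| exp (- omega_|k| b) + O(1/M).
   - Two summations by parts give |c^M_k| <= C / k^2 uniformly in M, which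
     dominates the sum while M tends to infinity.
   The equality f (i y) = f (T + i y) comes from the equality of all derivatives
   at 0 and T, hence of the Taylor series there, and from the identity theorem
   along the segment.  For the second part the same bound holds for all b, and
   letting b tend to infinity every frequency k <> 0 contributes 0. *)

(** In the estimates, f and the exponentials enter through first-order expansions whose quadratic
    remainder has a constant uniform on a rectangle. On a grid of M nodes each sum then collects M
    remainders of size 1/M^2. The passage to height b is cut into M steps of height b / M for the
    same reason: each step changes the undivided sum by O(1/M), so the whole passage costs O(1)
    before the division by M. The constant in the resulting O(1/M) depends on k, so the exponential
    bound serves only finitely many frequencies at once, whereas the grid carries M of them. The
    bound C / k^2 fixes a cut-off K, and M is chosen after K. Only multiples of N are used for M, so
    that the N nodes lie on the finer grid. Periodicity is given for weak derivatives of the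
    restriction to the real axis. They are identified with the classical derivatives by testing
    against explicit C^1 bumps. *)

Notation normc := Normc.normc.

(** * Complex norm, limits and power series *)

Section ComplexNorm.
Context {R : realType}.
Implicit Types (z w : R[i]) (x : R).

Lemma normc_ge0 z : 0 <= normc z.
Proof. by case: z => a b; exact: sqrtr_ge0. Qed.

Lemma normcD z w : normc (z + w) <= normc z + normc w.
Proof. exact: le_normcD. Qed.

Lemma normcN z : normc (- z) = normc z.
Proof. exact: (@complex.normcN R z). Qed.

Lemma normcB z w : normc (z - w) <= normc z + normc w.
Proof. by rewrite -(normcN w) normcD. Qed.

Lemma normc_distC z w : normc (z - w) = normc (w - z).
Proof. by rewrite -normcN opprB. Qed.

Lemma normc_sum (I : Type) (r : seq I) (P : pred I) (F : I -> R[i]) :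
  normc (\sum_(i <- r | P i) F i) <= \sum_(i <- r | P i) normc (F i).
Proof.
elim/big_ind2: _ => [|z x w y zx wy|//]; first by rewrite Normc.normc0.
exact: le_trans (normcD _ _) (lerD zx wy).
Qed.

Lemma normcX z n : normc (z ^+ n) = normc z ^+ n.
Proof.
elim: n => [|n IH]; first by rewrite !expr0 Normc.normc1.
by rewrite !exprS Normc.normcM IH.
Qed.

Lemma normc_real x : normc x%:C = `|x|.
Proof. by rewrite /normc /= expr0n /= addr0 sqrtr_sqr. Qed.

Lemma natCE n : (n%:R : R[i]) = (n%:R : R)%:C.
Proof. by rewrite (rmorph_nat (real_complex R)). Qed.

Lemma normc_nat n : normc (n%:R : R[i]) = n%:R.
Proof. by rewrite natCE normc_real ger0_norm. Qed.

Lemma ReD z w : complex.Re (z + w) = complex.Re z + complex.Re w.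
Proof. by case: z; case: w. Qed.

Lemma ImD z w : complex.Im (z + w) = complex.Im z + complex.Im w.
Proof. by case: z; case: w. Qed.

Lemma normc_Re z : `|complex.Re z| <= normc z.
Proof.
by case: z => a b /=; rewrite -sqrtr_sqr ler_wsqrtr // lerDl sqr_ge0.
Qed.

Lemma normc_Im z : `|complex.Im z| <= normc z.
Proof.
by case: z => a b /=; rewrite -sqrtr_sqr ler_wsqrtr // lerDr sqr_ge0.
Qed.

Lemma normc_le_ReIm z : normc z <= `|complex.Re z| + `|complex.Im z|.
Proof.
case: z => a b /=; rewrite -[leRHS]ger0_norm ?addr_ge0// -sqrtr_sqr ler_wsqrtr //.
rewrite sqrrD !real_normK ?num_real// lerD2r lerDl.
by rewrite pmulrn_lge0// mulr_ge0.
Qed.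

Lemma normc_eq0 z : (normc z == 0) = (z == 0).
Proof.
apply/eqP/eqP => [/Normc.eq0_normc//|->]; exact: Normc.normc0.
Qed.

Lemma normc_gt0 z : (0 < normc z) = (z != 0).
Proof. by rewrite lt0r normc_eq0 normc_ge0 andbT. Qed.

Lemma normc_small_eq0 z (C : R) :
  (forall e, 0 < e -> normc z <= C * e) -> z = 0.
Proof.
move=> H; apply/eqP/negPn/negP; rewrite -normc_gt0 => z0.
have C0 : 0 < C by have := lt_le_trans z0 (H 1 ltr01); rewrite mulr1.
have := H (normc z / (2 * C)) _.
rewrite divr_gt0 ?mulr_gt0// => /(_ isT); rewrite invfM mulrCA mulrA mulrAC -mulrA.
rewrite [X in _ * X](_ : _ = 2^-1); last by field; rewrite gt_eqF.
by lra.
Qed.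

End ComplexNorm.

Section ComplexLimits.
Context {R : realType}.
Implicit Types (p q : nat -> R[i]) (l m c z : R[i]).

(** Convergence is spelled out with the real-valued modulus, so that all estimates stay in [R]. *)
Definition ccvg p l := forall e : R, 0 < e ->
  exists n0, forall n, (n0 <= n)%N -> normc (p n - l) < e.

Lemma ccvgD p q l m : ccvg p l -> ccvg q m -> ccvg (fun n => p n + q n) (l + m).
Proof.
move=> pl qm e e0.
have [|n1 H1] := pl (e / 2); first by rewrite divr_gt0.
have [|n2 H2] := qm (e / 2); first by rewrite divr_gt0.
exists (maxn n1 n2) => n; rewrite geq_max => /andP[/H1 h1 /H2 h2].
have -> : p n + q n - (l + m) = (p n - l) + (q n - m) by ring.
by have := normcD (p n - l) (q n - m); lra.
Qed.

Lemma ccvgMr p l c : ccvg p l -> ccvg (fun n => p n * c) (l * c).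
Proof.
move=> pl e e0.
have c0 := normc_ge0 c.
have [|n0 H] := pl (e / (normc c + 1)); first by rewrite divr_gt0 ?ltr_wpDl.
exists n0 => n /H; rewrite -mulrBl Normc.normcM ltr_pdivlMr ?ltr_wpDl//.
by have := normc_ge0 (p n - l); nra.
Qed.

Lemma ccvgB p q l m : ccvg p l -> ccvg q m -> ccvg (fun n => p n - q n) (l - m).
Proof.
move=> pl /(ccvgMr (-1)) qm; rewrite -(mulrN1 m).
by under eq_fun => n do rewrite -(mulrN1 (q n)); exact: ccvgD.
Qed.

Lemma ccvg_le p l (B : R) : ccvg p l -> (forall n, normc (p n) <= B) ->
  normc l <= B.
Proof.
move=> pl pB; rewrite leNgt; apply/negP => lB.
have [|n H] := pl (normc l - B); first by rewrite subr_gt0.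
have := H n (leqnn n); have := pB n; have := normcD (p n) (l - p n).
by rewrite subrKC normc_distC; lra.
Qed.

Lemma ccvg_cst l : ccvg (fun=> l) l.
Proof. by move=> e e0; exists 0%N => n _; rewrite subrr Normc.normc0. Qed.

Lemma ccvg_unique p l m : ccvg p l -> ccvg p m -> l = m.
Proof.
move=> pl pm; apply/eqP; rewrite -subr_eq0 -normc_eq0 eq_le normc_ge0 andbT.
by apply: (ccvg_le (ccvgB pl pm)) => n; rewrite subrr Normc.normc0.
Qed.

Lemma ccvg_shift p l : ccvg (fun n => p n.+1) l -> ccvg p l.
Proof.
move=> pl e /pl[n0 H]; exists n0.+1 => -[//|n]; exact: H.
Qed.

Lemma ccvg_shiftS p l : ccvg p l -> ccvg (fun n => p n.+1) l.
Proof. by move=> pl e /pl[n0 H]; exists n0 => n /leqW; exact: H. Qed.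

Lemma sum_half n : \sum_(i < n) 2^-1 ^+ i <= 2 :> R.
Proof.
suff -> : \sum_(i < n) 2^-1 ^+ i = 2 - 2 * 2^-1 ^+ n :> R.
  by rewrite gerBl mulr_ge0// exprn_ge0.
elim: n => [|n IH]; first by rewrite big_ord0 expr0; ring.
by rewrite big_ord_recr /= IH exprS; field.
Qed.

Lemma geometric_cvg (c : nat -> R) (B : R) :
  (forall n, `|c n| <= B * 2^-1 ^+ n) -> cvgn (series c).
Proof.
move=> cB; apply: normed_cvg.
have B0 : 0 <= B.
  by have := cB 0%N; rewrite expr0 mulr1; apply: le_trans.
apply: (@series_le_cvg _ _ (geometric B 2^-1)) => [n|n|n|].
- exact: normr_ge0.
- by rewrite /geometric /= mulr_ge0// exprn_ge0.
- exact: cB.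
- by apply: is_cvg_geometric_series; rewrite gtr0_norm//; lra.
Qed.

(** Real and imaginary parts are dominated by the same geometric series, so completeness of [R]
    suffices. *)
Lemma ccvg_geometric (c : nat -> R[i]) (B : R) :
  (forall n, normc (c n) <= B * 2^-1 ^+ n) ->
  exists l, ccvg (fun n => \sum_(i < n) c i) l.
Proof.
move=> cB.
have reE n : complex.Re (\sum_(i < n) c i) = series (fun n => complex.Re (c n)) n.
  rewrite /series /= big_mkord.
  exact: (big_morph (fun z => complex.Re z) ReD).
have imE n : complex.Im (\sum_(i < n) c i) = series (fun n => complex.Im (c n)) n.
  rewrite /series /= big_mkord.
  exact: (big_morph (fun z => complex.Im z) ImD).
have /cvgrPdist_lt reC : cvgn (series (fun n => complex.Re (c n))).
  by apply: (@geometric_cvg _ B) => n; exact: le_trans (normc_Re _) (cB n).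
have /cvgrPdist_lt imC : cvgn (series (fun n => complex.Im (c n))).
  by apply: (@geometric_cvg _ B) => n; exact: le_trans (normc_Im _) (cB n).
exists (limn (series (fun n => complex.Re (c n))) +i* limn (series (fun n => complex.Im (c n)))).
move=> e e0; have e20 : 0 < e / 2 by rewrite divr_gt0.
have [n1 _ H1] := reC _ e20; have [n2 _ H2] := imC _ e20.
exists (maxn n1 n2) => n; rewrite geq_max => /andP[/H1 h1 /H2 h2].
apply: le_lt_trans (normc_le_ReIm _) _.
rewrite [e]splitr; move: h1 h2; rewrite /= -reE -imE.
by case: (\sum_(i < n) c i) => a b /= h1 h2; apply: ltrD; rewrite distrC.
Qed.

End ComplexLimits.

(** * Power series: coefficient bounds and second-order remainders *)

Section PowerSeries.
Context {R : realType}.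
Implicit Types (f g d : R[i] -> R[i]) (z w h k : R[i]) (a b : nat -> R[i]).

Definition has_ps f z a := exists2 r : R, 0 < r &
  forall h, normc h < r -> ccvg (fun n => \sum_(i < n) a i * h ^+ i) (f (z + h)).

Lemma nbhs_normc (P : R[i] -> Prop) z :
  (\forall w \near (z : R[i]^o), P w) ->
  exists2 r : R, 0 < r & forall h, normc h < r -> P (z + h).
Proof.
(* The radius is a complex number; being positive in the partial order of [R[i]] forces it to be
   real. *)
move=> /nbhs_ballP[r r0 H]; move: r r0 H => [r1 r2] /=; rewrite ltcE /=.
move=> /andP[/eqP-> r0] H; exists r1 => // h hr; apply: H.
rewrite /ball /= opprD addrA subrr add0r normrN normc_def ltcE /= eqxx.
by case: h hr.
Qed.

Lemma analytic_at_has_ps f z : analytic_at f z -> exists a, has_ps f z a.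
Proof.
move=> [a /nbhs_normc[r r0 H]]; exists a, r => // h /H{H} H e e0.
have E : (fun n => a n * (z + h - z) ^+ n) = (fun n => a n * h ^+ n).
  by apply/funext => n; rewrite (addrC z) addrK.
have {}H : series (fun n => a n * h ^+ n : R[i]^o) @ \oo --> (f (z + h) : R[i]^o).
  by rewrite -E.
have /cvgrPdist_lt/(_ e%:C) := H; rewrite ltcR => /(_ e0)[n0 _ K].
exists n0 => n /K; rewrite /= /series /= big_mkord.
rewrite normc_def ltcE /= => /andP[_]; rewrite normc_distC.
by case: (f _ - _).
Qed.

Lemma has_ps0 f z a : has_ps f z a -> a 0%N = f z.
Proof.
move=> [r r0 /(_ 0)]; rewrite Normc.normc0 addr0 => /(_ r0) H.
apply: (ccvg_unique _ H); apply: ccvg_shift.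
under eq_fun => n.
  rewrite big_ord_recl expr0 mulr1 big1 ?addr0; last first.
    by move=> i _; rewrite lift0 expr0n mulr0.
  over.
exact: ccvg_cst.
Qed.

Lemma has_psB f g z a b : has_ps f z a -> has_ps g z b ->
  has_ps (fun w => f w - g w) z (fun n => a n - b n).
Proof.
move=> [r r0 fa] [s s0 gb]; exists (Num.min r s); first by rewrite lt_min r0.
move=> h; rewrite lt_min => /andP[/fa{}fa /gb{}gb].
have := ccvgB fa gb; under eq_fun => n do rewrite -sumrB.
by under eq_fun => n do under eq_bigr => i _ do rewrite -mulrBl.
Qed.

Lemma has_ps_translate f z w a : has_ps f (z + w) a ->
  has_ps (fun t => f (t + w)) z a.
Proof. by move=> [r r0 H]; exists r => // h; rewrite addrAC; exact: H. Qed.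

(** Convergence at the single point h = r / 2 is enough: beyond n0 each term is the difference of
    two partial sums within 1 of the limit, hence at most 2 in modulus. Taking rho = r / 8 leaves a
    factor 4: one factor 2 is spent in [pow_taylor], the other makes the series geometric. *)
Lemma has_ps_coef_bound f z a : has_ps f z a ->
  exists rho B : R, [/\ 0 < rho, 0 <= B,
    forall n, normc (a n) * (4 * rho) ^+ n <= B &
    forall h, normc h < rho ->
      ccvg (fun n => \sum_(i < n) a i * h ^+ i) (f (z + h))].
Proof.
move=> [r r0 H].
pose h0 : R[i] := (r / 2)%:C.
have nh0 : normc h0 = r / 2 by rewrite normc_real gtr0_norm// divr_gt0.
have [|n0 K] := H h0 _ 1 ltr01; first by rewrite nh0; lra.
pose t n := normc (a n) * (r / 2) ^+ n.
have t0 n : 0 <= t n by rewrite mulr_ge0 ?normc_ge0// exprn_ge0// divr_ge0// ltW.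
exists (r / 8), (2 + \sum_(i < n0) t i); split.
- by rewrite divr_gt0.
- by rewrite addr_ge0// sumr_ge0.
- move=> n; rewrite (_ : 4 * (r / 8) = r / 2); last by field.
  rewrite -/(t n); have [nn0|nn0] := ltnP n n0.
    rewrite (bigD1 (Ordinal nn0)) //= addrCA lerDl addr_ge0//.
    by rewrite sumr_ge0.
  have tE : t n = normc (\sum_(i < n.+1) a i * h0 ^+ i - f (z + h0) -
      (\sum_(i < n) a i * h0 ^+ i - f (z + h0))).
    rewrite big_ord_recr /= [X in normc X](_ : _ = a n * h0 ^+ n); last by ring.
    by rewrite Normc.normcM normcX nh0.
  have := normcB (\sum_(i < n.+1) a i * h0 ^+ i - f (z + h0))
      (\sum_(i < n) a i * h0 ^+ i - f (z + h0)).
  rewrite -tE; have := K n nn0; have := K n.+1 (leqW nn0).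
  have : 0 <= \sum_(i < n0) t i by rewrite sumr_ge0.
  by lra.
- by move=> h hr; apply: H; lra.
Qed.

(** The remainder t_n of the n-th power satisfies t_(n+1) = w t_n + n z^(n-1) (w - z)^2, and n <=
    2^n. The factor rho^2 stands on the left to avoid the exponent n - 2. *)
Lemma pow_taylor (rho : R) z w n : normc z <= rho -> normc w <= rho ->
  normc (w ^+ n - z ^+ n - n%:R * z ^+ n.-1 * (w - z)) * rho ^+ 2 <=
  (2 * rho) ^+ n * normc (w - z) ^+ 2.
Proof.
move=> zr wr; have r0 := le_trans (normc_ge0 z) zr.
have d0 := sqr_ge0 (normc (w - z)).
elim: n => [|n IH].
  by rewrite !expr0 mul0r subrr mul0r subr0 Normc.normc0 mul0r mul1r.
rewrite (_ : w ^+ n.+1 - _ - _ = w * (w ^+ n - z ^+ n - n%:R * z ^+ n.-1 * (w - z)) +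
   n%:R * z ^+ n.-1 * (w - z) ^+ 2); last first.
  by case: n {IH} => [|n] /=; rewrite ?exprS ?expr0 -?natr1; ring.
set t := _ - _ - _ in IH *.
have h1 : normc (w * t) * rho ^+ 2 <= rho * ((2 * rho) ^+ n * normc (w - z) ^+ 2).
  rewrite Normc.normcM -mulrA.
  apply: ler_pM => //; first exact: normc_ge0.
  by rewrite mulr_ge0 ?normc_ge0// exprn_ge0.
have h2 : normc (n%:R * z ^+ n.-1 * (w - z) ^+ 2) * rho ^+ 2 <=
    rho * ((2 * rho) ^+ n * normc (w - z) ^+ 2).
  rewrite Normc.normcM normcX mulrAC mulrA ler_wpM2r// Normc.normcM normcX normc_nat.
  case: n {IH h1} @t => [|n] t /=; first by rewrite !mul0r mulr1.
  rewrite mulrAC (_ : rho * _ = 2 ^+ n.+1 * rho ^+ 2 * rho ^+ n); last first.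
    by rewrite exprMn !exprS; ring.
  apply: ler_pM; rewrite ?mulr_ge0 ?exprn_ge0 ?normc_ge0//.
    by rewrite ler_wpM2r ?exprn_ge0// -natrX ler_nat ltnW// ltn_expl.
  by rewrite lerXn2r// nnegrE normc_ge0.
have := normcD (w * t) (n%:R * z ^+ n.-1 * (w - z) ^+ 2).
move/(ler_wpM2r (exprn_ge0 2 r0))/le_trans; apply.
rewrite mulrDl (le_trans (lerD h1 h2))//.
by rewrite [(2 * rho) ^+ n.+1]exprS le_eqVlt; apply/orP; left; apply/eqP; ring.
Qed.

Definition dcoef a n : R[i] := n.+1%:R * a n.+1.

(** Comparison with the geometric series of ratio 1/2: coefficients are at most B / (4 rho)^n, while
    powers, differentiated terms and remainders grow at most like (2 rho)^n up to powers of rho. The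
    remainder is controlled between any two points of the disc, not only from its centre. *)
Lemma has_ps_taylor f z a : has_ps f z a -> exists rho B : R, exists d, [/\ 0 < rho,
  forall h, normc h < rho -> ccvg (fun n => \sum_(i < n) dcoef a i * h ^+ i) (d h) &
  forall h k, normc h < rho -> normc k < rho ->
    [/\ normc (f (z + h)) <= B, normc (d h) <= B &
        normc (f (z + k) - f (z + h) - d h * (k - h)) <= B * normc (k - h) ^+ 2]].
Proof.
move=> /has_ps_coef_bound[rho [B [rho0 B0 aB fa]]].
have aB' n : normc (a n) <= B / (4 * rho) ^+ n.
  by rewrite ler_pdivlMr// exprn_gt0// mulr_gt0.
have rV : rho \is a GRing.unit by rewrite unitfE gt_eqF.
have half n : (4 * rho) ^- n * (2 * rho) ^+ n = 2^-1 ^+ n.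
  rewrite -exprVn -exprMn; congr (_ ^+ n); field; exact: lt0r_neq0.
have db h n : normc h < rho -> normc (dcoef a n * h ^+ n) <= (B / rho) * 2^-1 ^+ n.
  move=> hr; rewrite !Normc.normcM normcX normc_nat.
  have nn : n.+1%:R <= 2 ^+ n.+1 :> R by rewrite -natrX ler_nat ltnW// ltn_expl.
  have hn : normc h ^+ n <= rho ^+ n by rewrite lerXn2r ?nnegrE ?normc_ge0 ?ltW.
  apply: (@le_trans _ _ ((2 ^+ n.+1 * (B / (4 * rho) ^+ n.+1)) * rho ^+ n)).
    apply: ler_pM => //; rewrite ?mulr_ge0 ?normc_ge0 ?exprn_ge0 ?normc_ge0//.
    by apply: ler_pM => //; exact: normc_ge0.
  rewrite -[leLHS]mulr1 -[X in _ * X](mulVf (lt0r_neq0 rho0)).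
  rewrite (_ : _ * _ = (B / rho) * ((4 * rho) ^- n.+1 * (2 * rho) ^+ n.+1)); last first.
    by rewrite [(2 * rho) ^+ _]exprMn [rho ^+ n.+1]exprS; set X := _ ^- _; ring.
  rewrite half exprS ler_wpM2l ?divr_ge0 ?(ltW rho0)//.
  by rewrite ler_piMl ?exprn_ge0//; lra.
have [d dP] : exists d : R[i] -> R[i], forall h, normc h < rho ->
    ccvg (fun n => \sum_(i < n) dcoef a i * h ^+ i) (d h).
  suff /choice[d dP] : forall h, exists l, normc h < rho ->
    ccvg (fun n => \sum_(i < n) dcoef a i * h ^+ i) l by exists d.
  move=> h; have [hr|] := ltP (normc h) rho; last by exists 0.
  have [l Hl] := ccvg_geometric (fun n => db h n hr).
  by exists l.
have C1 : 0 <= B / rho by rewrite divr_ge0 ?(ltW rho0).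
have C2 : 0 <= B / rho ^+ 2 by rewrite divr_ge0 ?exprn_ge0 ?(ltW rho0).
exists rho, (2 * (B + B / rho + B / rho ^+ 2)), d; split => // h k hr kr; split.
- have : normc (f (z + h)) <= B * 2.
    apply: (ccvg_le (fa h hr)) => n; apply: le_trans (normc_sum _ _ _) _.
    apply: le_trans (ler_wpM2l B0 (sum_half n)); rewrite mulr_sumr.
    apply: ler_sum => i _; rewrite Normc.normcM normcX -half.
    rewrite mulrA; apply: ler_pM => //; rewrite ?normc_ge0 ?exprn_ge0 ?normc_ge0//.
    by rewrite lerXn2r ?nnegrE ?normc_ge0 ?mulr_ge0 ?(ltW rho0)//; lra.
  by lra.
- have : normc (d h) <= (B / rho) * 2.
    apply: (ccvg_le (dP h hr)) => n; apply: le_trans (normc_sum _ _ _) _.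
    apply: le_trans (ler_wpM2l C1 (sum_half n)); rewrite mulr_sumr.
    by apply: ler_sum => i _; exact: db.
  by lra.
- have : normc (f (z + k) - f (z + h) - d h * (k - h)) <=
      (B / rho ^+ 2 * normc (k - h) ^+ 2) * 2.
    have D0 : 0 <= B / rho ^+ 2 * normc (k - h) ^+ 2 by rewrite mulr_ge0// sqr_ge0.
    (* The partial sums of f are taken one term longer, because [dcoef] lowers the index by one. *)
    have {}L := ccvgB (ccvgB (ccvg_shiftS (fa k kr)) (ccvg_shiftS (fa h hr)))
     (ccvgMr (k - h) (dP h hr)).
    apply: (ccvg_le L) => n.
    rewrite (_ : _ - _ = \sum_(i < n.+1)
       a i * (k ^+ i - h ^+ i - i%:R * h ^+ i.-1 * (k - h))); last first.
      transitivity (\sum_(i < n.+1) (a i * k ^+ i - a i * h ^+ i) -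
           \sum_(i < n.+1) i%:R * a i * h ^+ i.-1 * (k - h)).
        rewrite sumrB; congr (_ - _); rewrite mulr_suml big_ord_recl /= !mul0r add0r.
        by apply: eq_bigr => i _; rewrite /dcoef.
      by rewrite -sumrB; apply: eq_bigr => i _; ring.
    apply: le_trans (normc_sum _ _ _) _.
    apply: le_trans (ler_wpM2l D0 (sum_half n.+1)); rewrite mulr_sumr.
    apply: ler_sum => i _; rewrite Normc.normcM -half.
    have T := pow_taylor i (ltW hr) (ltW kr).
    rewrite -ler_pdivlMr ?exprn_gt0// in T.
    apply: le_trans (ler_pM (normc_ge0 _) (normc_ge0 _) (aB' i) T) _.
    by rewrite le_eqVlt; apply/orP; left; apply/eqP; ring.
  have := sqr_ge0 (normc (k - h)).
  by nra.
Qed.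

End PowerSeries.

(** * Complex derivatives and the identity theorem on a segment *)

Section ComplexDerivative.
Context {R : realType}.
Implicit Types (f g d : R[i] -> R[i]) (z w h k : R[i]) (a b : nat -> R[i]).

(* 0 where f has no first-order expansion with a quadratic remainder *)
Definition cderiv f z : R[i] := xget 0 [set d | exists r B : R, 0 < r /\
  forall h, normc h < r -> normc (f (z + h) - f z - d * h) <= B * normc h ^+ 2].

(** Two candidates d and d' satisfy |d' - d| t <= (B + B') t^2 at small real increments t > 0, so
    they coincide. *)
Lemma cderivE f z (d : R[i]) (r B : R) : 0 < r ->
  (forall h, normc h < r -> normc (f (z + h) - f z - d * h) <= B * normc h ^+ 2) ->
  cderiv f z = d.
Proof.
move=> r0 H; apply: xget_unique; first by exists r, B.
move=> d' [r' [B' [r'0 H']]]; apply/eqP; rewrite -subr_eq0; apply/eqP.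
apply: (@normc_small_eq0 _ _ `|B + B'|) => e e0.
pose t := Num.min e (Num.min r r' / 2).
have m0 : 0 < Num.min r r' by rewrite lt_min r0.
have t0 : 0 < t by rewrite lt_min e0 divr_gt0.
have te : t <= e by rewrite ge_min lexx.
have tm : t < Num.min r r'.
  by apply: (@le_lt_trans _ _ (Num.min r r' / 2)); [rewrite ge_min lexx orbT|lra].
move: tm; rewrite lt_min => /andP[tr tr'].
have nt : normc (t%:C : R[i]) = t by rewrite normc_real gtr0_norm.
have h1 := H t%:C; have h2 := H' t%:C.
rewrite nt in h1 h2; move: (h1 tr) (h2 tr') => {}h1 {}h2.
have : normc ((d' - d) * t%:C) <= (B + B') * t ^+ 2.
  rewrite (_ : _ * _ = (f (z + t%:C) - f z - d * t%:C) -
    (f (z + t%:C) - f z - d' * t%:C)); last by ring.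
  by apply: le_trans (normcB _ _) _; lra.
rewrite Normc.normcM nt expr2 mulrA ler_pM2r// => /le_trans; apply.
apply: (@le_trans _ _ (`|B + B'| * t)); last by rewrite ler_wpM2l.
by rewrite ler_wpM2r ?ler_norm// ltW.
Qed.

(* The remainder is uniform in both points, so that compactness yields a single
   radius and constant on a rectangle. *)
Definition quad f d z0 := exists r B : R, 0 < r /\
  forall z w, normc (z - z0) < r -> normc (w - z0) < r ->
    [/\ normc (f z) <= B, normc (d z) <= B &
        normc (f w - f z - d z * (w - z)) <= B * normc (w - z) ^+ 2].

(** As the remainder in [has_ps_taylor] is uniform in the base point, [cderiv f] is the sum of the
    differentiated series on a whole disc. Hence [cderiv] preserves expansions and can be
    iterated. *)
Lemma has_ps_cderiv_quad f z a : has_ps f z a ->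
  has_ps (cderiv f) z (dcoef a) /\ quad f (cderiv f) z.
Proof.
move=> /has_ps_taylor[rho [B [d [rho0 dP H]]]].
have dE h : normc h < rho -> cderiv f (z + h) = d h.
  move=> hr; apply: (@cderivE _ _ _ (rho - normc h) B); first by rewrite subr_gt0.
  move=> k kr; have hk : normc (h + k) < rho by have := normcD h k; lra.
  by have [_ _] := H h (h + k) hr hk; rewrite addrA (addrC h k) addrK.
split; first by exists rho => // h hr; rewrite dE//; exact: dP.
exists rho, B; split=> // u v zr wr; have := H _ _ zr wr.
rewrite -dE// !subrKC.
by rewrite (_ : v - z - _ = v - u) //; ring.
Qed.

Lemma has_ps_quad f z a : has_ps f z a -> quad f (cderiv f) z.
Proof. by case/has_ps_cderiv_quad. Qed.

Lemma has_ps_iter f z a n : has_ps f z a -> has_ps (iter n cderiv f) z (iter n dcoef a).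
Proof.
move=> fa; elim: n => //= n IH; exact: (has_ps_cderiv_quad IH).1.
Qed.

Lemma iter_dcoef a n : iter n dcoef a 0%N = n`!%:R * a n.
Proof.
elim: n a => [|n IH] a; first by rewrite mul1r.
by rewrite iterSr IH /dcoef mulrA -natrM factS mulnC.
Qed.

Lemma eq_iter_cderiv_coef f g z w a b : has_ps f z a -> has_ps g w b ->
  (forall n, iter n cderiv f z = iter n cderiv g w) -> a = b.
Proof.
move=> fa gb fg; apply/funext => n.
have := fg n; rewrite -(has_ps0 (has_ps_iter n fa)) -(has_ps0 (has_ps_iter n gb)).
rewrite !iter_dcoef; apply: mulfI; rewrite -normc_eq0 normc_nat.
by rewrite pnatr_eq0 -lt0n fact_gt0.
Qed.

Lemma has_ps_eq_near f g z w a : has_ps f z a -> has_ps g w a ->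
  exists2 r : R, 0 < r & forall h, normc h < r -> f (z + h) = g (w + h).
Proof.
move=> [r r0 fa] [s s0 ga]; exists (Num.min r s); first by rewrite lt_min r0.
by move=> h; rewrite lt_min => /andP[/fa{}fa /ga]; exact: ccvg_unique.
Qed.

Definition clustered_zeros f z := forall r : R, 0 < r ->
  exists h, [/\ 0 < normc h, normc h < r & f (z + h) = 0].

(** At a zero z + h the expansion gives |f z| <= |cderiv f z| |h| + B |h|^2, and for |h| < 1 both
    terms are at most |B| |h|. *)
Lemma clustered_zeros_eq0 f z a : has_ps f z a -> clustered_zeros f z -> f z = 0.
Proof.
move=> fa H; have [r [B [r0 Q]]] := has_ps_quad fa.
apply: (@normc_small_eq0 _ _ (2 * `|B|)) => e e0.
have [|h [h0 hm fh]] := H (Num.min e (Num.min 1 r)); first by rewrite !lt_min e0 ltr01.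
move: hm; rewrite !lt_min => /and3P[he h1 hr].
have zh : z + h - z = h by ring.
have := Q z (z + h); rewrite subrr Normc.normc0 zh fh sub0r => /(_ r0 hr)[_ d1 d2].
have := normcB (- f z - cderiv f z * h) (- (cderiv f z * h)).
rewrite opprK subrK !normcN Normc.normcM.
have Bn := ler_norm B; have dz0 := normc_ge0 (cderiv f z).
have X1 : B * normc h ^+ 2 <= `|B| * normc h.
  rewrite expr2 mulrA ler_pM2r//; apply: (@le_trans _ _ (`|B| * normc h)).
    by rewrite ler_pM2r.
  by rewrite ler_piMr// ltW.
have X2 : normc (cderiv f z) * normc h <= `|B| * normc h.
  by rewrite ler_pM2r// (le_trans d1).
have X3 : `|B| * normc h <= `|B| * e by rewrite ler_wpM2l// ltW.
by lra.
Qed.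

(* f vanishes at z; dividing f by w - z shifts the coefficients down and keeps
   the other zeros. *)
Lemma has_ps_zeros f z a : has_ps f z a -> clustered_zeros f z -> forall n, a n = 0.
Proof.
move=> fa H n; elim: n f a fa H => [|n IH] f a fa H.
  by rewrite (has_ps0 fa) (clustered_zeros_eq0 fa H).
have a0 : a 0%N = 0 by rewrite (has_ps0 fa) (clustered_zeros_eq0 fa H).
(* The value at z is the one that removes the singularity of the quotient. *)
pose f1 w := if w == z then a 1%N else f w / (w - z).
apply: (IH f1 (fun n => a n.+1)); last first.
  move=> r /H[h [h0 hr fh]]; exists h; split => //.
  rewrite /f1 fh mul0r ifF//; apply/negbTE; rewrite -subr_eq0.
  by rewrite (_ : z + h - z = h) -?normc_gt0 //; ring.
have [r r0 fr] := fa; exists r => // h /fr {}fr.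
have [->|h0] := eqVneq h 0.
  rewrite addr0 /f1 eqxx; apply: ccvg_shift.
  under eq_fun => m.
    rewrite big_ord_recl expr0 mulr1 big1 ?addr0; last first.
      by move=> i _; rewrite lift0 expr0n mulr0.
    over.
  exact: ccvg_cst.
rewrite /f1 -subr_eq0 (_ : z + h - z = h); last by ring.
rewrite (negbTE h0).
have := ccvgMr h^-1 (ccvg_shiftS fr); congr ccvg; apply/funext => m.
rewrite big_ord_recl a0 mul0r add0r mulr_suml; apply: eq_bigr => i _.
by rewrite lift0 exprSr mulrA mulfK.
Qed.

End ComplexDerivative.

(** * Continuation along vertical segments and uniform constants on rectangles *)

Section Rectangles.
Context {R : realType}.
Implicit Types (f g d : R[i] -> R[i]) (z w h : R[i]) (T b : R).

Lemma Complex_sub (x y u v : R) : (x +i* y) - (u +i* v) = (x - u) +i* (y - v).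
Proof. by []. Qed.

Lemma normc_pure_im (y : R) : normc (0 +i* y) = `|y|.
Proof. by rewrite /normc expr0n /= add0r sqrtr_sqr. Qed.

(** Connectedness of the segment: the set [S] of heights near which f agrees with its translate by T
    is open and contains 0. It is closed in the segment because heights of [S] accumulating at y
    yield clustering zeros of the difference, so that the two expansions at height y coincide. *)
Lemma eq_translate_segment f T b : 0 <= b ->
  (forall y, - b <= y <= b -> exists a, has_ps f (0 +i* y) a) ->
  (forall y, - b <= y <= b -> exists a, has_ps f (T +i* y) a) ->
  (exists2 r : R, 0 < r & forall h, normc h < r -> f (0 + h) = f (T%:C + h)) ->
  forall y, - b <= y <= b ->
  exists2 r : R, 0 < r & forall h, normc h < r -> f ((0 +i* y) + h) = f ((T +i* y) + h).
Proof.
move=> b0 f0 fT near0.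
pose S : set R := [set y | exists2 r : R, 0 < r &
  forall h, normc h < r -> f ((0 +i* y) + h) = f ((T +i* y) + h)].
suff H : `[- b, b]%classic `&` S = `[- b, b]%classic.
  move=> y yb; have : `[- b, b]%classic y by rewrite /= in_itv.
  by rewrite -H => -[].
apply: segment_connected.
- by exists 0; split; rewrite /= ?in_itv /= ?oppr_le0 ?b0.
- exists S => //; rewrite openE => y [r r0 yr].
  apply/nbhs_ballP; exists (r / 2) => /=; first by rewrite divr_gt0.
  move=> y'; rewrite /ball /= => yy'; exists (r / 2); first by rewrite divr_gt0.
  move=> h hr.
  have E (u : R) : (u +i* y') + h = (u +i* y) + ((0 +i* (y' - y)) + h).
    by rewrite addrA; congr (_ + _); apply/eqP; rewrite eq_complex /= addr0 subrKC !eqxx.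
  rewrite !E; apply: yr; apply: le_lt_trans (normcD _ _) _.
  by rewrite normc_pure_im distrC; lra.
- exists (closure S); first exact: closed_closure.
  apply/seteqP; split=> y [yb]; first by move=> yS; split => //; exact: subset_closure.
  move=> yS; split => //.
  have [//|nyS] := pselect (S y).
  move: yb; rewrite /= in_itv /= => yb.
  have [a fa] := f0 _ yb; have [a' fa'] := fT _ yb.
  have ga' : has_ps (fun t => f (t + T%:C)) (0 +i* y) a'.
    by apply: has_ps_translate; rewrite (_ : _ + _ = T +i* y)//;
      apply/eqP; rewrite eq_complex /= add0r addr0 !eqxx.
  have E h : (0 +i* y) + h + T%:C = (T +i* y) + h.
    rewrite addrAC; congr (_ + _).
    by apply/eqP; rewrite eq_complex /= add0r addr0 !eqxx.
  have aa' : a = a'.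
    apply/funext => n; apply/eqP; rewrite -subr_eq0; apply/eqP; move: n.
    apply: (has_ps_zeros (has_psB fa ga')) => r r0.
    have [y' [y'S]] := yS _ (nbhsx_ballx y r r0).
    rewrite /ball /= => yy'; exists (0 +i* (y' - y)); rewrite normc_pure_im distrC.
    split => //.
      by rewrite normr_gt0 subr_eq0; apply/eqP => yE; apply: nyS; rewrite yE.
    have [s s0 /(_ 0)] := y'S; rewrite Normc.normc0 => /(_ s0) fy'.
    rewrite E (_ : (0 +i* y) + _ = (0 +i* y') + 0); last first.
      by apply/eqP; rewrite eq_complex /= !addr0 subrKC !eqxx.
    rewrite (_ : (T +i* y) + _ = (T +i* y') + 0) ?fy' ?subrr//.
    by apply/eqP; rewrite eq_complex /= !addr0 subrKC !eqxx.
  subst a'; have [r r0 H] := has_ps_eq_near fa ga'.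
  by exists r => // h /H; rewrite E.
Qed.

(** Compactness of the rectangle, with one integer parameter n playing both parts: the radius is 1 /
    (n + 1) and the bound is n. *)
Lemma quad_uniform T b f d : (forall z, rect T b z -> quad f d z) ->
  exists rho B : R, 0 < rho /\ forall z w, rect T b z -> normc (w - z) < rho ->
    [/\ normc (f z) <= B, normc (d z) <= B &
        normc (f w - f z - d z * (w - z)) <= B * normc (w - z) ^+ 2].
Proof.
move=> H.
pose K : set (R * R) := `[0, T] `*` `[- b, b].
have : compact K by apply: compact_setX; exact: segment_compact.
move=> /compact_near_coveringP/(_ nat \oo (fun n p => forall w,
    normc (w - (p.1 +i* p.2)) < n.+1%:R^-1 ->
    [/\ normc (f (p.1 +i* p.2)) <= n%:R, normc (d (p.1 +i* p.2)) <= n%:R &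
        normc (f w - f (p.1 +i* p.2) - d (p.1 +i* p.2) * (w - (p.1 +i* p.2))) <=
        n%:R * normc (w - (p.1 +i* p.2)) ^+ 2]) _).
case=> [[x y] /= [xT yb]|n0 _ K0].
  have [|r [B [r0 Q]]] := H (x +i* y).
    by move: xT yb; rewrite /= !in_itv.
  have m0 : 0 <= `|B| + 2 / r by rewrite addr_ge0// divr_ge0// ltW.
  (* For n >= N the bound n exceeds B and the radius 1 / (n + 1) is below r / 2. *)
  pose N := Num.bound (`|B| + 2 / r).
  have NB : `|B| + 2 / r < N%:R by exact: archi_boundP.
  exists (ball ((x, y) : R * R) (r / 4), [set n | (N <= n)%N]) => /=.
    by split; [apply: nbhsx_ballx; rewrite divr_gt0|exists N].
  move=> [[x' y'] n] /= [[]]; rewrite /ball /= => xx' yy' Nn w /= wz.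
  have nN : N%:R <= n%:R :> R by rewrite ler_nat.
  have Bn : B <= n%:R by have := ler_norm B; have := divr_ge0 (ler0n R 2) (ltW r0); lra.
  have nr : n.+1%:R^-1 < r / 2.
    rewrite -[ltRHS]invf_div ltf_pV2 ?posrE ?divr_gt0//.
    by rewrite -[n.+1%:R]natr1; have := normr_ge0 B; lra.
  have z'z : normc ((x' +i* y') - (x +i* y)) < r / 2.
    rewrite Complex_sub; apply: le_lt_trans (normc_le_ReIm _) _ => /=.
    by rewrite distrC (distrC y'); lra.
  have wz' : normc (w - (x +i* y)) < r.
    rewrite (_ : w - _ = (w - (x' +i* y')) + ((x' +i* y') - (x +i* y))); last by ring.
    by apply: le_lt_trans (normcD _ _) _; rewrite [r]splitr ltrD// (lt_trans wz).
  have z'r : normc ((x' +i* y') - (x +i* y)) < r by lra.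
  have [q1 q2 q3] := Q _ _ z'r wz'.
  split; [exact: le_trans q1 _|exact: le_trans q2 _|].
  by apply: le_trans q3 _; rewrite ler_wpM2r// sqr_ge0.
exists n0.+1%:R^-1, n0%:R; split => //.
move=> [x y] w /= [zx zy] wz; have := K0 n0 (leqnn _) (x, y).
by apply => //=; rewrite !in_itv.
Qed.

End Rectangles.

(** * Periodicity of the derivatives of smooth functions in the periodic Sobolev spaces *)

Section RealDerivatives.
Context {R : realType}.
Implicit Types (f p phi : R -> R) (x y a b c T r B : R).

Lemma is_derive_quad f x c r B : 0 < r ->
  (forall h, `|h| < r -> `|f (x + h) - f x - c * h| <= B * h ^+ 2) ->
  is_derive x 1 f c.
Proof.
move=> r0 H.
have L : h^-1 *: (f (h *: 1 + x) - f x) @[h --> 0^'] --> c.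
  apply/cvgrPdist_lt => e e0.
  have m0 : 0 < Num.min r (e / (`|B| + 1)).
    by rewrite lt_min r0 divr_gt0// ltr_wpDl.
  near=> h.
  have h0 : h != 0 by near: h; exact: nbhs_dnbhs_neq.
  have : `|h| < Num.min r (e / (`|B| + 1)).
    near: h; apply/nbhs_ballP; exists (Num.min r (e / (`|B| + 1))) => //= h.
    by rewrite /ball /= sub0r normrN.
  rewrite lt_min => /andP[hr]; rewrite ltr_pdivlMr ?ltr_wpDl// => he.
  have /= := H h hr; rewrite (addrC x) [h *: 1]mulr1 /GRing.scale /= => Hh.
  rewrite -[X in X - _](mulKf h0) -mulrBr normrM normfV ltr_pdivrMl ?normr_gt0//.
  rewrite distrC [h * c]mulrC; apply: le_lt_trans Hh _.
  rewrite -real_normK ?num_real// expr2 mulrA mulrC.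
  rewrite ltr_pM2l ?normr_gt0//.
  have := ler_norm B; have := normr_ge0 B; have : 0 < `|h| by rewrite normr_gt0.
  by nra.
split; first by apply/cvg_ex; exists c.
exact: cvg_lim L.
Unshelve. all: by end_near.
Qed.

(* max(0, (x - a)(b - x))^2, which is of class C^1 *)
Definition bump a b x : R := let q := (x - a) * (b - x) in (q + `|q|) ^+ 2 / 4.

Definition dbump a b x : R := let q := (x - a) * (b - x) in
  (q + `|q|) * (a + b - 2 * x).

(** The bump is max(0, t)^2 composed with a quadratic polynomial; the former has derivative t + |t|,
    and both have a remainder of at most h^2. *)
Lemma is_derive_bump a b x : is_derive x 1 (bump a b) (dbump a b x).
Proof.
pose s (t : R) : R := (t + `|t|) ^+ 2 / 4.
pose q (x : R) : R := (x - a) * (b - x).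
have Ds (t : R) : is_derive t 1 s (t + `|t|).
  apply: (@is_derive_quad _ _ _ 1 1) => // h _; rewrite /s mul1r ler_norml.
  case: (ger0P (t + h)) => ?; case: (ger0P t) => ?; apply/andP; split; nra.
have Dq : is_derive x 1 q (a + b - 2 * x).
  apply: (@is_derive_quad _ _ _ 1 1) => // h _; rewrite /q mul1r.
  rewrite (_ : _ - _ = - h ^+ 2); last by ring.
  by rewrite normrN ger0_norm ?sqr_ge0.
exact: is_derive1_comp (Ds (q x)) Dq.
Qed.

Lemma derive1_bump a b : derive1 (bump a b) = dbump a b.
Proof. by apply/funext => x; rewrite derive1E; case: (is_derive_bump a b x). Qed.

Lemma bump_ge0 a b x : 0 <= bump a b x.
Proof. by rewrite /bump divr_ge0// sqr_ge0. Qed.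

Lemma bump_eq0 a b x : ~~ (a < x < b) -> a <= b -> bump a b x = 0.
Proof.
move=> abx ab; have q0 : (x - a) * (b - x) <= 0.
  by move: abx; rewrite negb_and -!leNgt => /orP[]?; nra.
by rewrite /bump ler0_norm// subrr expr0n mul0r.
Qed.

Lemma continuous_bump a b : continuous (bump a b).
Proof.
move=> x; apply: differentiable_continuous; apply/derivable1_diffP.
exact: (@ex_derive _ _ _ _ _ _ _ (is_derive_bump a b x)).
Qed.

Lemma test_function_bump T a b : 0 < a -> a <= b -> b < T -> test_function T (bump a b).
Proof.
move=> a0 ab bT; split.
- by move=> x; exact: (@ex_derive _ _ _ _ _ _ _ (is_derive_bump a b x)).
- rewrite derive1_bump /dbump => x.
  have cq : {for x, continuous (fun x : R => (x - a) * (b - x))}.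
    apply: cvgM; first by apply: cvgB; [exact: cvg_id|exact: cvg_cst].
    by apply: cvgB; [exact: cvg_cst|exact: cvg_id].
  apply: cvgM; first by apply: cvgD => //; exact: cvg_norm.
  apply: cvgB; first exact: cvg_cst.
  by apply: cvgM; [exact: cvg_cst|exact: cvg_id].
- apply: (@subset_trans _ `[a, b]); last first.
    by move=> x /=; rewrite !in_itv /= => /andP[ax xb]; rewrite (lt_le_trans a0)//= (le_lt_trans xb).
  rewrite closureE; apply: smallest_sub; first exact: interval_closed.
  move=> x /= /eqP; rewrite in_itv /=; apply: contra_notT => abx; apply: bump_eq0 => //.
  by apply: contra abx => /andP[/ltW-> /ltW->].
Qed.

Lemma within_continuous_integrable a b p : {within `[a, b], continuous p} ->
  lebesgue_measure.-integrable `[a, b] (EFin \o p).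
Proof. by move=> cp; apply: continuous_compact_integrable => //; exact: segment_compact. Qed.

Lemma within_continuousM (A : set R) p q : {within A, continuous p} ->
  {within A, continuous q} -> {within A, continuous (fun x => p x * q x)}.
Proof. by move=> cp cq x; apply: cvgM; [exact: cp|exact: cq]. Qed.

(** The integrand is non-negative, and on the middle third of [a, b], of length m = (b - a) / 3,
    both x - a and b - x are at least m. The integrand is therefore at least c m^4 there, and a zero
    integral would give c m^5 <= 0. *)
Lemma Rintegral_bump_gt0 T p a b c : 0 < a -> a < b -> b < T -> 0 < c ->
  {within `[0, T], continuous p} -> (forall x, a <= x <= b -> c <= p x) ->
  \int[lebesgue_measure]_(x in `[0, T]) (p x * bump a b x) != 0.
Proof.
move=> a0 ab bT c0 cp pc; apply/eqP => int0.
have cpb : {within `[0, T], continuous (fun x => p x * bump a b x)}.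
  apply: within_continuousM => //; apply: continuous_subspaceT; exact: continuous_bump.
have intpb := within_continuous_integrable cpb.
have {int0} int0 : (\int[lebesgue_measure]_(x in `[0%R, T]) (p x * bump a b x)%:E = 0)%E.
  by rewrite -[LHS]fineK ?[X in X%:E]int0//; exact: integrable_fin_num.
pose m := (b - a) / 3; have m0 : 0 < m by rewrite /m divr_gt0 ?subr_gt0.
have sub x : x \in `[a + m, b - m] -> a < x < b.
  by rewrite in_itv /= => /andP[? ?]; apply/andP; split; lra.
have subT : `[a + m, b - m]%classic `<=` `[0, T]%classic.
  by move=> x /= /sub /andP[? ?]; rewrite in_itv /=; apply/andP; split; lra.
have pb0 x : 0 <= p x * bump a b x.
  have [/andP[ax xb]|abx] := boolP (a < x < b); last by rewrite (bump_eq0 abx (ltW ab)) mulr0.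
  rewrite mulr_ge0 ?bump_ge0// (le_trans (ltW c0)) ?pc//.
  by rewrite (ltW ax) (ltW xb).
have mpb := measurable_int _ intpb.
have int_ge : (\int[lebesgue_measure]_(x in `[(a + m)%R, (b - m)%R]) (p x * bump a b x)%:E <= 0)%E.
  rewrite -int0; apply: ge0_subset_integral => //.
  by move=> x _; rewrite lee_fin.
have : (\int[lebesgue_measure]_(x in `[(a + m)%R, (b - m)%R]) (cst (c * m ^+ 4)%:E x) <= 0)%E.
  apply: le_trans int_ge; apply: ge0_le_integral => //.
  - by move=> x _; rewrite lee_fin mulr_ge0 ?exprn_ge0 ?ltW.
  - exact: measurable_funS mpb.
  move=> x xab; rewrite lee_fin; have /andP[ax xb] := sub x xab.
  apply: ler_pM; rewrite ?exprn_ge0 ?(ltW c0) ?(ltW m0)//; first by rewrite pc// (ltW ax) (ltW xb).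
  have xm : m <= x - a by move: xab; rewrite /= in_itv /= => /andP[? _]; lra.
  have bm : m <= b - x by move: xab; rewrite /= in_itv /= => /andP[_ ?]; lra.
  have mq : m ^+ 2 <= (x - a) * (b - x) by rewrite expr2; apply: ler_pM => //; exact: ltW.
  rewrite /bump ger0_norm; last by apply: le_trans mq; exact: sqr_ge0.
  have := sqr_ge0 m; rewrite -[4%N]/(2 * 2)%N exprM; nra.
rewrite integral_cst//= lebesgue_measure_itv /= lte_fin ifT; last by rewrite /m; lra.
rewrite -EFinB -EFinM lee_fin leNgt => /negP; apply.
by rewrite mulr_gt0// ?mulr_gt0 ?exprn_gt0// /m; lra.
Qed.

(** By symmetry under p -> - p it suffices to exclude p x > 0. Then p > p x / 2 near x, and a bump
    supported there has a non-zero integral against p. *)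
Lemma du_bois_reymond T p : 0 < T -> {within `[0, T], continuous p} ->
  (forall phi, test_function T phi -> continuous phi ->
    \int[lebesgue_measure]_(x in `[0, T]) (p x * phi x) = 0) ->
  forall x, x \in `[0, T] -> p x = 0.
Proof.
move=> T0.
suff H : forall p, {within `[0, T], continuous p} ->
  (forall phi, test_function T phi -> continuous phi ->
    \int[lebesgue_measure]_(x in `[0, T]) (p x * phi x) = 0) ->
  forall x, x \in `[0, T] -> p x <= 0.
  move=> cp p0 x xT; apply/eqP; rewrite eq_le H//=.
  have := H (fun x => - p x) _ _ x xT; rewrite oppr_le0; apply => //.
    by move=> y; apply: cvgN; exact: cp.
  move=> phi phiT cphi; under eq_Rintegral do rewrite mulNr -mulN1r.
  rewrite RintegralZl ?p0 ?mulr0//; apply: within_continuous_integrable.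
  by apply: within_continuousM => //; exact: continuous_subspaceT.
move=> {}p cp p0 x xT; rewrite leNgt; apply/negP => px.
have e0 : 0 < p x / 2 by rewrite divr_gt0.
have [d d0 dP] : exists2 d : R, 0 < d & forall y, y \in `[0, T] -> `|y - x| < d -> p x / 2 < p y.
  have /subspace_continuousP/(_ x xT)/cvgrPdist_lt/(_ _ e0) := cp.
  rewrite /prop_near1 /within /= => /nbhs_ballP[d /= d0 dP]; exists d => // y yT yx.
  have := dP y; rewrite /ball /= distrC => /(_ yx yT); rewrite ltr_norml => /andP[_ h].
  have {}h : p x - p y < p x / 2 := h.
  by lra.
have [a [b [a0 ab bT abd]]] : exists a b : R, [/\ 0 < a, a < b, b < T &
   forall y, a <= y <= b -> `|y - x| < d].
  (* Since x may be an end of [0, T], the bump sits beside x, on the side of the farther end. *)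
  pose m := Num.min (d / 2) (T / 4).
  have m0 : 0 < m by rewrite lt_min !divr_gt0.
  have md : m <= d / 2 by rewrite ge_min lexx.
  have mT : m <= T / 4 by rewrite ge_min lexx orbT.
  move: xT; rewrite in_itv /= => /andP[x0 xT].
  have [xT2|xT2] := leP x (T / 2).
    exists (x + m / 2), (x + m); split; try lra.
    by move=> y /andP[? ?]; rewrite ger0_norm; lra.
  exists (x - m), (x - m / 2); split; try lra.
  by move=> y /andP[? ?]; rewrite ler0_norm; lra.
have abT y : a <= y <= b -> y \in `[0, T].
  by move=> /andP[ay yb]; rewrite in_itv /=; apply/andP; split; lra.
have := p0 _ (test_function_bump a0 (ltW ab) bT) (@continuous_bump a b).
apply/eqP; apply: (Rintegral_bump_gt0 a0 ab bT e0 cp) => y yab.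
by apply/ltW/dP; [exact: abT|exact: abd].
Qed.

(** By induction the representatives g i of the weak derivatives equal the classical derivatives v i
    on [0, T]: integration by parts for v i and the weak identity for g i make the continuous
    function g (i + 1) - v (i + 1) orthogonal to all test functions. *)
Lemma periodic_derivatives T (v : nat -> R -> R) : 0 < T ->
  (forall j x, x \in `[0, T] -> is_derive x 1 (v j) (v j.+1 x)) ->
  (forall s, periodic_sobolev_real T s (v 0%N)) -> forall j, v j 0 = v j T.
Proof.
move=> T0 Dv Sv j.
have cv i : {within `[0, T], continuous (v i)}.
  apply: derivable_within_continuous => x xT.
  exact: (@ex_derive _ _ _ _ _ _ _ (Dv i x xT)).
have dLR i : derivable_oo_LRcontinuous (v i) 0 T.
  have [_ cL cR] := (continuous_within_itvP (v i) T0).1 (cv i).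
  split=> // x xT; have /Dv xD : x \in `[0, T] by apply: subset_itvW xT.
  exact: (@ex_derive _ _ _ _ _ _ _ (xD i)).
(* Order j + 1 is taken because equal boundary values are granted only strictly below the order. *)
have [g [g0 _ gW gC _]] := Sv j.+1.
suff H i : (i <= j)%N -> {in `[0, T], g i =1 v i}.
  have [_ gT] := gC j (ltnSn j).
  by rewrite -!(H j (leqnn j)) ?in_itv /= ?lexx ?ltW.
elim: i => [//|i IH] ij x xT.
have {IH} gv := IH (ltnW ij).
apply/eqP; rewrite -subr_eq0; apply/eqP; move: x xT.
have [cg _] := gC i.+1 ij.
apply: (@du_bois_reymond _ (fun x => g i.+1 x - v i.+1 x)) => //.
  by move=> x; apply: cvgB; [exact: cg|exact: cv].
move=> phi phiT cphi; have [dphi cdphi sphi] := phiT.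
have cphi' : {within `[0, T], continuous phi} by exact: continuous_subspaceT.
under eq_Rintegral do rewrite mulrBl.
rewrite RintegralB //; [|apply: within_continuous_integrable; exact: within_continuousM..].
have phi0 y : ~ `]0, T[%classic y -> phi y = 0.
  move=> yT; apply/eqP/negPn/negP => py; apply: yT; apply: sphi.
  exact: subset_closure.
have := gW i (leqW ij) phi phiT.
have -> : \int[lebesgue_measure]_(x in `[0, T]) (g i x * derive1 phi x) =
    \int[lebesgue_measure]_(x in `[0, T]) (v i x * derive1 phi x).
  by apply: eq_Rintegral => x; rewrite inE => /gv ->.
rewrite (@Rintegration_by_parts _ (v i) phi (v i.+1) (derive1 phi)) //.
- rewrite !phi0 ?mulr0 ?subrr ?sub0r; last 2 first.
  + by rewrite /= in_itv /= ltxx.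
  + by rewrite /= in_itv /= ltxx andbF.
  by move=> /eqP; rewrite eqr_opp => /eqP ->; rewrite subrr.
- move=> x xT; rewrite derive1E; have /Dv xD : x \in `[0, T] by apply: subset_itvW xT.
  by case: (xD i).
- exact: continuous_subspaceT.
- split; [by []|apply: cvg_at_right_filter|apply: cvg_at_left_filter]; exact: cphi.
Qed.

End RealDerivatives.

(** * Exponentials *)

Section Exponentials.
Context {R : realType}.
Implicit Types (f g d : R[i] -> R[i]) (z w h : R[i]) (T b t x y k : R).

Lemma MVT0 (f df : R -> R) x : (forall t : R, is_derive t (1 : R) f (df t)) ->
  exists2 c, `|c| <= `|x| & f x = f 0 + df c * x.
Proof.
move=> Df; have cf : continuous f.
  move=> t; apply: differentiable_continuous; apply/derivable1_diffP.
  exact: (@ex_derive _ _ _ _ _ _ _ (Df t)).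
have [x0|x0] := leP 0 x.
  have [c] := MVT_segment x0 (fun t _ => Df t) (continuous_subspaceT cf).
  rewrite in_itv /= subr0 => /andP[c0 cx] E; exists c; last by rewrite -E; ring.
  by rewrite !ger0_norm.
have [c] := MVT_segment (ltW x0) (fun t _ => Df t) (continuous_subspaceT cf).
rewrite in_itv /= sub0r => /andP[cx c0] E; exists c; last first.
  by rewrite -[df c * x]opprK -mulrN -E; ring.
by rewrite !ler0_norm ?lerN2 // ltW.
Qed.

Lemma norm_sin_le x : `|sin x| <= `|x|.
Proof.
have [c _ ->] := MVT0 x (@is_derive_sin R).
by rewrite sin0 add0r normrM ler_piMl// cos_max.
Qed.

Lemma norm_cosB1_le x : `|cos x - 1| <= x ^+ 2.
Proof.
have [c cx ->] := MVT0 x (@is_derive_cos R).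
rewrite cos0 addrC addKr normrM normrN -real_normK ?num_real// expr2.
by rewrite ler_wpM2r// (le_trans (norm_sin_le c)).
Qed.

Lemma norm_cosB1_le1 x : `|cos x - 1| <= `|x|.
Proof.
have [c _ ->] := MVT0 x (@is_derive_cos R).
by rewrite cos0 addrC addKr normrM normrN ler_piMl// sin_max.
Qed.

Lemma norm_sinB_le x : `|sin x - x| <= x ^+ 2.
Proof.
have [c cx ->] := MVT0 x (@is_derive_sin R).
rewrite sin0 add0r -{2}[x]mul1r -mulrBl normrM -real_normK ?num_real// expr2.
by rewrite ler_wpM2r// (le_trans (norm_cosB1_le1 c)).
Qed.

(** Up to 1/2, sin t >= t - t^2 >= t / 2. Beyond, sin is increasing, so sin x >= sin (1/2) >= 1/4,
    and x <= pi / 2 < 2. *)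
Lemma sin_ge x : 0 <= x <= pi / 2 -> x / 8 <= sin x.
Proof.
move=> /andP[x0 xpi]; have pi2 := pihalf_lt2 R.
have H t : 0 <= t <= 2^-1 -> t / 2 <= sin t.
  move=> /andP[t0 t2]; have := norm_sinB_le t; rewrite ler_norml => /andP[+ _].
  by nra.
have [x2|x2] := leP x 2^-1; first by have := H x; rewrite x0 x2 => /(_ isT); lra.
have := H 2^-1; rewrite lexx invr_ge0 ler0n => /(_ isT) h.
have : sin 2^-1 < sin x by rewrite ltr_sin// in_itv /=; apply/andP; split; lra.
by lra.
Qed.

Lemma expiD x y : expi (x + y) = expi x * expi y.
Proof.
by apply/eqP; rewrite eq_complex /= cosD sinD eqxx /= addrC.
Qed.

Lemma expi0 : expi (0 : R) = 1.
Proof. by rewrite /expi cos0 sin0. Qed.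

Lemma normc_expi x : normc (expi x) = 1.
Proof. by rewrite /normc /= cos2Dsin2 sqrtr1. Qed.

Lemma expi_neq0 x : expi x != 0.
Proof. by rewrite -normc_eq0 normc_expi oner_eq0. Qed.

Lemma expiN x : expi (- x) = (expi x)^-1.
Proof. by apply: (mulIf (expi_neq0 x)); rewrite -expiD addNr expi0 mulVf// expi_neq0. Qed.

Lemma expiX x n : expi x ^+ n = expi (x * n%:R).
Proof.
elim: n => [|n IH]; first by rewrite mulr0 expi0 expr0.
by rewrite exprS IH -expiD -natr1 mulrDr mulr1 addrC.
Qed.

Lemma expi2pi : expi (2 * pi : R) = 1.
Proof. by rewrite /expi mulrC mulr_natr cos2pi sin2pi. Qed.

Lemma expi2pi_nat n : expi (2 * pi * n%:R : R) = 1.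
Proof. by rewrite -expiX expi2pi expr1n. Qed.

Lemma expi2pi_int (m : int) : expi (2 * pi * m%:~R : R) = 1.
Proof.
case: m => n; first exact: expi2pi_nat.
by rewrite NegzE mulrNz mulrN expiN [n.+1%:~R]/(n.+1%:R) expi2pi_nat invr1.
Qed.

Lemma normc_expiB1_sqr x : normc (expi x - 1) ^+ 2 = 4 * sin (x / 2) ^+ 2.
Proof.
rewrite /normc /= sqr_sqrtr ?addr_ge0 ?sqr_ge0// subr0.
have -> : cos x = 1 - 2 * sin (x / 2) ^+ 2.
  have {1}-> : x = (x / 2) *+ 2 by rewrite -mulr_natr; field.
  by rewrite cos_mulr2n cos2sin2 -mulr_natr; ring.
have -> : sin x = 2 * sin (x / 2) * cos (x / 2).
  have {1}-> : x = (x / 2) + (x / 2) by rewrite -splitr.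
  by rewrite sinD; ring.
by rewrite exprMn cos2sin2; ring.
Qed.

(** The modulus is 2 |sin (x / 2)|. This bounds from below the divisor produced by summation by
    parts. *)
Lemma normc_expiB1_ge x : `|x| <= pi -> `|x| / 8 <= normc (expi x - 1).
Proof.
move=> xpi; rewrite -(@ler_pXn2r _ 2) ?nnegrE ?normc_ge0 ?divr_ge0//.
rewrite normc_expiB1_sqr.
have H : `|x| / 2 / 8 <= `|sin (x / 2)|.
  have := @sin_ge (`|x| / 2); rewrite divr_ge0//= ler_pM2r// => /(_ xpi)/le_trans; apply.
  by case: (ger0P x) => _; rewrite ?mulNr ?sinN ?ler_norm// -[leRHS]normrN ler_norm.
rewrite -[leRHS]mulrC -[sin _ ^+ 2]real_normK ?num_real//.
rewrite (_ : (`|x| / 8) ^+ 2 = (`|x| / 2 / 8) ^+ 2 * 4); last by field.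
rewrite ler_wpM2r// ler_pXn2r// nnegrE// !divr_ge0//.
Qed.

(* exp (- i k z) *)
Definition cexp k z : R[i] :=
  (expR (k * complex.Im z))%:C * expi (- (k * complex.Re z)).

Lemma cexpD k z w : cexp k (z + w) = cexp k z * cexp k w.
Proof.
rewrite /cexp ReD ImD !mulrDr expRD opprD expiD rmorphM /=.
by rewrite -!mulrA; congr (_ * _); rewrite mulrCA.
Qed.

Lemma cexp_real k x : cexp k x%:C = expi (- (k * x)).
Proof. by rewrite /cexp /= mulr0 expR0 mul1r. Qed.

Lemma normc_cexp k z : normc (cexp k z) = expR (k * complex.Im z).
Proof. by rewrite Normc.normcM normc_expi mulr1 normc_real ger0_norm// expR_ge0. Qed.

(** All follows from 1 + s <= exp s, used at s and at - s; multiplied by exp s, the latter becomes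
    exp s - 1 <= s exp s. *)
Lemma expR_taylor (s M : R) : `|s| <= M ->
  `|expR s - 1| <= expR M * `|s| /\ `|expR s - 1 - s| <= expR M * s ^+ 2.
Proof.
move=> sM; have h1 := expR_ge1Dx s; have h2 := expR_ge1Dx (- s).
have M0 : 0 <= M by apply: le_trans sM.
have M1 : 1 <= expR M by rewrite -expR0 ler_expR.
have es := expR_gt0 s.
have h3 : (1 - s) * expR s <= 1.
  by have := ler_wpM2l (ltW es) h2; rewrite expRxMexpNx_1; lra.
have eM : expR s <= expR M by rewrite ler_expR; exact: le_trans (ler_norm _) sM.
have A : `|expR s - 1| <= expR M * `|s|.
  rewrite ler_norml; case: (ger0P s) => s0; apply/andP; split; nra.
split => //; rewrite ger0_norm; last by lra.
apply: (@le_trans _ _ (s * (expR s - 1))); first by nra.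
apply: le_trans (ler_norm _) _; rewrite normrM -real_normK ?num_real// expr2 mulrCA.
by rewrite ler_wpM2l.
Qed.

(** With a = k Im h and t = - k Re h one has - i k h = a + i t, so the claim splits into real
    expansions of exp at a and of cos and sin at t. Each of the two parts contributes 2 M k^2
    |h|^2. *)
Lemma cexp_taylor k : exists2 B : R, 0 <= B & forall h, normc h <= 1 ->
  normc (cexp k h - 1 + k%:C * 'i * h) <= B * normc h ^+ 2.
Proof.
pose M := expR `|k|; have M0 : 0 < M by exact: expR_gt0.
exists (4 * M * k ^+ 2); first by apply: mulr_ge0 (sqr_ge0 k); apply: mulr_ge0 (ltW M0).
move=> h h1; set a := k * complex.Im h; set t := - (k * complex.Re h).
have ah : `|a| <= `|k| * normc h by rewrite normrM ler_wpM2l// normc_Im.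
have th : `|t| <= `|k| * normc h by rewrite normrN normrM ler_wpM2l// normc_Re.
have kh : `|k| * normc h <= `|k| by rewrite ler_piMr.
have [e1 e2] := expR_taylor (le_trans ah kh).
have eaM : expR a <= M.
  by rewrite ler_expR; apply: le_trans (ler_norm _) _; exact: le_trans ah kh.
have ea0 := expR_ge0 a.
have sq : forall u, `|u| <= `|k| * normc h -> u ^+ 2 <= k ^+ 2 * normc h ^+ 2.
  move=> u uh; rewrite -(real_normK (num_real u)) -(real_normK (num_real k)) -exprMn.
  by rewrite lerXn2r// nnegrE// mulr_ge0// normc_ge0.
have a2 := sq _ ah; have t2 := sq _ th.
rewrite -[_ + _]/((expR a)%:C * expi t - 1 + k%:C * 'i * h).
have -> : (expR a)%:C * expi t - 1 + k%:C * 'i * h =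
    (expR a * cos t - 1 - a) +i* (expR a * sin t - t).
  rewrite /a /t; case: h {h1 a t ah th kh e1 e2 eaM ea0 sq a2 t2} => h1 h2.
  by apply/eqP; rewrite eq_complex /=; apply/andP; split; apply/eqP; ring.
apply: le_trans (normc_le_ReIm _) _ => /=.
have c1 : `|expR a * cos t - 1 - a| <= 2 * M * (k ^+ 2 * normc h ^+ 2).
  rewrite (_ : _ - a = (expR a - 1 - a) + expR a * (cos t - 1)); last by ring.
  apply: le_trans (ler_normD _ _) _; rewrite normrM (ger0_norm ea0).
  have := ler_pM ea0 (normr_ge0 _) eaM (norm_cosB1_le t).
  have := ler_wpM2l (ltW M0) a2; have := ler_wpM2l (ltW M0) t2.
  by move: e2; rewrite -/M; lra.
have c2 : `|expR a * sin t - t| <= 2 * M * (k ^+ 2 * normc h ^+ 2).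
  rewrite (_ : _ - t = expR a * (sin t - t) + (expR a - 1) * t); last by ring.
  apply: le_trans (ler_normD _ _) _; rewrite !normrM (ger0_norm ea0).
  have := ler_pM ea0 (normr_ge0 _) eaM (norm_sinB_le t).
  have := ler_wpM2l (ltW M0) t2.
  have : `|expR a - 1| * `|t| <= M * (k ^+ 2 * normc h ^+ 2).
    apply: (@le_trans _ _ ((M * `|a|) * `|t|)); first by rewrite ler_wpM2r.
    rewrite -mulrA ler_pM2l// -(real_normK (num_real k)) -exprMn expr2.
    by apply: ler_pM.
  lra.
by lra.
Qed.

(** Multiplicativity moves the expansion at 0 to any point; the radius 1/2 ensures |w - z| <= 1. *)
Lemma quad_cexp k z0 : quad (cexp k) (fun z => - (k%:C * 'i) * cexp k z) z0.
Proof.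
have [B B0 H] := cexp_taylor k.
pose M := expR (`|k| * (normc z0 + 1)).
have M0 : 0 < M by exact: expR_gt0.
have cM z : normc (z - z0) < 2^-1 -> normc (cexp k z) <= M.
  move=> zz; rewrite normc_cexp ler_expR; apply: le_trans (ler_norm _) _.
  rewrite normrM ler_wpM2l//; apply: le_trans (normc_Im _) _.
  rewrite -(subrK z0 z); apply: le_trans (normcD _ _) _.
  lra.
have ni : normc (- (k%:C * 'i) : R[i]) = `|k|.
  by rewrite normcN Normc.normcM normc_real normc_pure_im normr1 mulr1.
exists 2^-1, (M * (1 + `|k| + B)); split => // z w zz wz; split.
- have := cM _ zz; have := normr_ge0 k; nra.
- rewrite Normc.normcM ni; have := cM _ zz; have := normr_ge0 k.
  have := normc_ge0 (cexp k z); nra.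
rewrite (_ : _ - _ - _ = cexp k z * (cexp k (w - z) - 1 + k%:C * 'i * (w - z))); last first.
  have -> : cexp k w = cexp k z * cexp k (w - z) by rewrite -cexpD subrKC.
  by ring.
rewrite Normc.normcM.
have wz1 : normc (w - z) <= 1.
  rewrite (_ : w - z = (w - z0) - (z - z0)); last by ring.
  by apply: le_trans (normcB _ _) _; lra.
have := ler_pM (normc_ge0 _) (normc_ge0 _) (cM _ zz) (H _ wz1).
move/le_trans; apply; rewrite mulrA; apply: ler_wpM2r; first exact: sqr_ge0.
by rewrite ler_pM2l//; have := normr_ge0 k; lra.
Qed.

Lemma quadM f g d d' z0 : quad f d z0 -> quad g d' z0 ->
  quad (fun z => f z * g z) (fun z => d z * g z + f z * d' z) z0.
Proof.
move=> [r [B [r0 fB]]] [s [C [s0 gC]]].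
pose D := `|B| + `|C| + 1; have BD : B <= D by have := ler_norm B; have := normr_ge0 C; rewrite /D; lra.
have CD : C <= D by have := ler_norm C; have := normr_ge0 B; rewrite /D; lra.
have D1 : 1 <= D by have := normr_ge0 C; have := normr_ge0 B; rewrite /D; lra.
have D0 : 0 <= D by lra.
pose q := Num.min (Num.min r s) 2^-1.
exists q, (4 * D ^+ 2); split; first by rewrite !lt_min r0 s0 invr_gt0 /=.
move=> z w; rewrite !lt_min => /andP[/andP[zr zs] z1] /andP[/andP[wr ws] w1].
have [f1 f2 f3] := fB z w zr wr; have [g1 g2 g3] := gC z w zs ws.
have f1D := le_trans f1 BD; have f2D := le_trans f2 BD.
have g1D := le_trans g1 CD; have g2D := le_trans g2 CD.
have fgD : normc (f z) * normc (g z) <= D ^+ 2.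
  by rewrite expr2; apply: ler_pM => //; exact: normc_ge0.
have dgD : normc (d z) * normc (g z) <= D ^+ 2.
  by rewrite expr2; apply: ler_pM => //; exact: normc_ge0.
have fdD : normc (f z) * normc (d' z) <= D ^+ 2.
  by rewrite expr2; apply: ler_pM => //; exact: normc_ge0.
have D2 : 0 <= D ^+ 2 by exact: sqr_ge0.
split; first by rewrite Normc.normcM; lra.
  by apply: le_trans (normcD _ _) _; rewrite !Normc.normcM; lra.
set h := w - z; set e := f w - f z - d z * h; set e' := g w - g z - d' z * h.
have gw : normc (g w) <= D by have [+ _ _] := gC w w ws ws; move/le_trans; apply.
(* Product rule with the remainders e and e' of f and g. The last term is quadratic in h because g
   is Lipschitz near z0. *)
rewrite (_ : _ - _ - _ = e * g w + f z * e' + d z * h * (g w - g z)); last first.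
  by rewrite /e /e'; ring.
set n2 := normc (w - z) ^+ 2; have n0 : 0 <= n2 by exact: sqr_ge0.
have eD : normc e <= D * n2 by apply: le_trans f3 _; rewrite ler_wpM2r.
have eD' : normc e' <= D * n2 by apply: le_trans g3 _; rewrite ler_wpM2r.
have h1 : normc h <= 1.
  rewrite /h (_ : w - z = (w - z0) - (z - z0)); last by ring.
  by apply: le_trans (normcB _ _) _; lra.
have gwz : normc (g w - g z) <= 2 * D * normc h.
  rewrite (_ : g w - g z = e' + d' z * h); last by rewrite /e'; ring.
  apply: le_trans (normcD _ _) _; rewrite Normc.normcM.
  have : normc (d' z) * normc h <= D * normc h by rewrite ler_wpM2r// normc_ge0.
  have : D * n2 <= D * normc h by rewrite ler_wpM2l// /n2 expr2 ler_piMl// normc_ge0.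
  lra.
apply: le_trans (normcD _ _) _.
have t1 : normc (e * g w + f z * e') <= 2 * D ^+ 2 * n2.
  apply: le_trans (normcD _ _) _; rewrite !Normc.normcM.
  have := ler_pM (normc_ge0 _) (normc_ge0 _) eD gw.
  have := ler_pM (normc_ge0 _) (normc_ge0 _) f1D eD'.
  lra.
have t2 : normc (d z * h * (g w - g z)) <= 2 * D ^+ 2 * n2.
  rewrite !Normc.normcM.
  have A : normc (d z) * normc h <= D * normc h by rewrite ler_wpM2r// normc_ge0.
  have := ler_pM (mulr_ge0 (normc_ge0 _) (normc_ge0 _)) (normc_ge0 _) A gwz.
  rewrite /n2 -/h; lra.
lra.
Qed.

End Exponentials.

(** * Shifting Riemann sums vertically *)

Section Periodicity.
Context {R : realType}.
Implicit Types (f g d : R[i] -> R[i]) (z w h : R[i]) (T b t x y : R).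

Lemma analytic_near_has_ps f K z : analytic_near f K -> K z -> exists a, has_ps f z a.
Proof. by move=> [U [_ KU Uf]] /KU/Uf/analytic_at_has_ps. Qed.

Lemma quad_is_derive f d x : quad f d x%:C ->
  is_derive x (1 : R) (fun t => complex.Re (f t%:C)) (complex.Re (d x%:C)) /\
  is_derive x (1 : R) (fun t => complex.Im (f t%:C)) (complex.Im (d x%:C)).
Proof.
move=> [r [B [r0 Q]]].
have Q' (h : R) : `|h| < r ->
    normc (f (x + h)%:C - f x%:C - d x%:C * h%:C) <= B * h ^+ 2.
  move=> hr; have E : (x + h)%:C - x%:C = h%:C by rewrite rmorphD /= addrC addKr.
  have := Q x%:C (x + h)%:C; rewrite subrr Normc.normc0 E normc_real.
  by move=> /(_ r0 hr)[_ _]; rewrite real_normK ?num_real.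
have ReE (u v w : R[i]) (t : R) : complex.Re (u - v - w * t%:C) =
    complex.Re u - complex.Re v - complex.Re w * t.
  by case: u v w => [? ?] [? ?] [? ?] /=; rewrite mulr0 subr0.
have ImE (u v w : R[i]) (t : R) : complex.Im (u - v - w * t%:C) =
    complex.Im u - complex.Im v - complex.Im w * t.
  by case: u v w => [? ?] [? ?] [? ?] /=; rewrite mulr0 add0r.
split; apply: (@is_derive_quad _ _ _ _ r B r0) => h /Q'; apply: le_trans.
- by rewrite -ReE normc_Re.
- by rewrite -ImE normc_Im.
Qed.

Lemma real_rect T b x : 0 <= b -> x \in `[0, T] -> rect T b x%:C.
Proof. by move=> b0; rewrite in_itv /rect /= oppr_le0 b0. Qed.

(** On the real axis, the real and imaginary parts of the iterated complex derivatives form two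
    chains of classical derivatives, to which [periodic_derivatives] applies. *)
Lemma spaceA_iter_periodic T b f n : 0 < T -> 0 <= b ->
  analytic_near f (rect T b) -> periodic_sobolev_oo T (fun x => f x%:C) ->
  iter n cderiv f 0 = iter n cderiv f T%:C.
Proof.
move=> T0 b0 fan Sf.
have D j x : x \in `[0, T] -> quad (iter j cderiv f) (iter j.+1 cderiv f) x%:C.
  move=> xT; have [a fa] := analytic_near_has_ps fan (real_rect b0 xT).
  exact: has_ps_quad (has_ps_iter j fa).
have HRe := @periodic_derivatives R T (fun j x => complex.Re (iter j cderiv f x%:C)) T0
  (fun j x xT => (quad_is_derive (D j x xT)).1) (fun s => (Sf s).1).
have HIm := @periodic_derivatives R T (fun j x => complex.Im (iter j cderiv f x%:C)) T0
  (fun j x xT => (quad_is_derive (D j x xT)).2) (fun s => (Sf s).2).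
by apply/eqP; rewrite eq_complex HRe HIm !eqxx.
Qed.

Lemma spaceA_periodic T b f : 0 < T -> 0 <= b ->
  analytic_near f (rect T b) -> periodic_sobolev_oo T (fun x => f x%:C) ->
  forall y, - b <= y <= b -> f (0 +i* y) = f (T +i* y).
Proof.
move=> T0 b0 fan Sf.
have H0 y : - b <= y <= b -> exists a, has_ps f (0 +i* y) a.
  by move=> yb; apply: (analytic_near_has_ps fan); split; rewrite /= ?lexx ?(ltW T0).
have HT y : - b <= y <= b -> exists a, has_ps f (T +i* y) a.
  by move=> yb; apply: (analytic_near_has_ps fan); split; rewrite /= ?lexx ?(ltW T0).
have b00 : - b <= 0 <= b by rewrite oppr_le0 b0.
have [a fa] := H0 0 b00; have [a' fa'] := HT 0 b00.
have aa' : a = a'.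
  by apply: (eq_iter_cderiv_coef fa fa') => n; exact: spaceA_iter_periodic fan Sf.
subst a'; move=> y yb.
have [r r0 /(_ 0)] := eq_translate_segment b0 H0 HT (has_ps_eq_near fa fa') yb.
by rewrite Normc.normc0 !addr0; apply.
Qed.

End Periodicity.

(** * Comparison of Riemann sums at two heights *)

Section VerticalShift.
Context {R : realType}.
Implicit Types (f g d : R[i] -> R[i]) (z w h : R[i]) (T b t x y : R).

Lemma nodeS T M j : node T M j.+1 = node T M j + T / M%:R :> R.
Proof. by rewrite /node -natr1 mulrDr mulr1 mulrDl. Qed.

Lemma node0 T M : node T M 0 = 0 :> R.
Proof. by rewrite /node mulr0 mul0r. Qed.

Lemma nodeT T M : (0 < M)%N -> node T M M = T :> R.
Proof. by move=> M0; rewrite /node mulfK// pnatr_eq0 -lt0n. Qed.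

Lemma node_itv T M j : 0 <= T -> (j <= M)%N -> (0 : R) <= node T M j <= T.
Proof.
move=> T0 jM; rewrite /node mulr_ge0 ?invr_ge0 ?mulr_ge0//=.
have [->|M0] := posnP M; first by rewrite invr0 mulr0.
by rewrite ler_pdivrMr ?ltr0n// ler_wpM2l// ler_nat.
Qed.

(** Let t = T / M and let S be the sum of the derivatives at the nodes. Since the horizontal
    increments telescope to 0, t S is minus a sum of M remainders of size B t^2, whence |S| <= M B
    t. The vertical step changes the sum of g by i dl S plus M remainders of size B dl^2. *)
Lemma sum_shift_le g d T b y dl rho B M : 0 < T -> (0 < M)%N ->
  (forall z w, rect T b z -> normc (w - z) < rho ->
    [/\ normc (g z) <= B, normc (d z) <= B &
        normc (g w - g z - d z * (w - z)) <= B * normc (w - z) ^+ 2]) ->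
  - b <= y <= b -> g (0 +i* y) = g (T +i* y) -> T / M%:R < rho -> `|dl| < rho ->
  normc (\sum_(j < M) g (node T M j +i* (y + dl)) - \sum_(j < M) g (node T M j +i* y)) <=
    M%:R * (B * (`|dl| * (T / M%:R) + dl ^+ 2)).
Proof.
move=> T0 M0 U yb gT hrho drho.
have Mr : 0 < M%:R :> R by rewrite ltr0n.
pose t := T / M%:R; have t0 : 0 < t by rewrite divr_gt0.
pose z j : R[i] := node T M j +i* y.
have rz j : (j < M)%N -> rect T b (z j).
  by move=> jM; split => //=; apply: node_itv; rewrite ?(ltW T0) ?(ltnW jM).
pose e (j : nat) := g (z j.+1) - g (z j) - d (z j) * t%:C.
have zS j : z j.+1 - z j = t%:C.
  by apply/eqP; rewrite eq_complex /= nodeS (addrC (node _ _ _)) addrK subrr !eqxx.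
have eB j : (j < M)%N -> normc (e j) <= B * t ^+ 2.
  move=> jM; have := U (z j) (z j.+1) (rz j jM).
  by rewrite zS normc_real gtr0_norm// => /(_ hrho)[].
pose S := \sum_(j < M) d (z j).
have tel : \sum_(j < M) (g (z j.+1) - g (z j)) = 0.
  rewrite -(big_mkord xpredT (fun j => g (z j.+1) - g (z j))) telescope_sumr//.
  by rewrite /z nodeT// node0 gT subrr.
have SB : normc S <= M%:R * (B * t).
  have SE : S * t%:C = - \sum_(j < M) e j.
    by rewrite /e sumrB tel sub0r opprK /S mulr_suml.
  rewrite -(ler_pM2r t0) -[X in normc S * X](gtr0_norm t0) -normc_real -Normc.normcM SE normcN.
  apply: le_trans (normc_sum _ _ _) _.
  apply: (@le_trans _ _ (\sum_(j < M) B * t ^+ 2)); first by apply: ler_sum => j _; exact: eB.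
  by rewrite sumr_const card_ord -[_ *+ M]mulr_natl expr2; lra.
pose e' (j : nat) := g (node T M j +i* (y + dl)) - g (z j) - d (z j) * (0 +i* dl).
have eB' j : (j < M)%N -> normc (e' j) <= B * dl ^+ 2.
  move=> jM; have := U (z j) (node T M j +i* (y + dl)) (rz j jM).
  have -> : (node T M j +i* (y + dl)) - z j = 0 +i* dl.
    by apply/eqP; rewrite eq_complex /= subrr (addrC y) addrK !eqxx.
  by rewrite normc_pure_im => /(_ drho)[_ _]; rewrite real_normK ?num_real.
have -> : \sum_(j < M) g (node T M j +i* (y + dl)) - \sum_(j < M) g (node T M j +i* y) =
    \sum_(j < M) e' j + S * (0 +i* dl).
  by rewrite /e' sumrB -mulr_suml subrK [RHS]sumrB.
apply: le_trans (normcD _ _) _.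
have h1 : normc (\sum_(j < M) e' j) <= M%:R * (B * dl ^+ 2).
  apply: le_trans (normc_sum _ _ _) _.
  apply: (@le_trans _ _ (\sum_(j < M) B * dl ^+ 2)); first by apply: ler_sum => j _; exact: eB'.
  by rewrite sumr_const card_ord -[_ *+ M]mulr_natl.
have h2 : normc (S * (0 +i* dl)) <= M%:R * (B * t) * `|dl|.
  by rewrite Normc.normcM normc_pure_im ler_wpM2r.
by rewrite -/t; lra.
Qed.

(** There are M steps of height y / M, each costing M B (|y| T + y^2) / M^2, so the total does not
    depend on M. *)
Lemma sum_vertical_shift g d T b y : 0 < T ->
  (forall z, rect T b z -> quad g d z) ->
  (forall y, - b <= y <= b -> g (0 +i* y) = g (T +i* y)) -> - b <= y <= b ->
  exists (C : R) (M0 : nat), forall M, (M0 <= M)%N ->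
  normc (\sum_(j < M) g (node T M j +i* y) - \sum_(j < M) g (node T M j +i* 0)) <= C.
Proof.
move=> T0 /quad_uniform[rho [B [rho0 U]]] gT yb.
have m0 : 0 <= (T + `|y|) / rho by rewrite divr_ge0 ?addr_ge0// ltW.
exists (B * (`|y| * T + y ^+ 2)), (Num.bound ((T + `|y|) / rho)) => M MM.
have Mrho : (T + `|y|) / rho < M%:R.
  by apply: lt_le_trans (archi_boundP m0) _; rewrite ler_nat.
have Mr : 0 < M%:R :> R by apply: le_lt_trans m0 Mrho.
have Mn : (0 < M)%N by rewrite -(ltr0n R).
move: Mrho; rewrite ltr_pdivrMr// => Mrho.
have h1 : T / M%:R < rho by rewrite ltr_pdivrMr//; have := normr_ge0 y; lra.
have h2 : `|y / M%:R| < rho.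
  by rewrite normrM normfV (gtr0_norm Mr) ltr_pdivrMr//; lra.
pose E := B * (`|y / M%:R| * (T / M%:R) + (y / M%:R) ^+ 2).
have step n : (n <= M)%N ->
  normc (\sum_(j < M) g (node T M j +i* (n%:R * (y / M%:R))) -
         \sum_(j < M) g (node T M j +i* 0)) <= n%:R * (M%:R * E).
  elim: n => [|n IH] nM; first by rewrite !mul0r subrr Normc.normc0.
  have ynb : - b <= n%:R * (y / M%:R) <= b.
    have n0 : 0 <= n%:R / M%:R :> R by rewrite divr_ge0.
    have n1 : n%:R / M%:R <= 1 :> R by rewrite ler_pdivrMr// mul1r ler_nat ltnW.
    by rewrite mulrCA mulrC; move: yb => /andP[? ?]; apply/andP; split; nra.
  have := sum_shift_le T0 Mn U ynb (gT _ ynb) h1 h2.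
  rewrite (_ : n%:R * (y / M%:R) + y / M%:R = n.+1%:R * (y / M%:R)); last first.
    by rewrite -natr1 mulrDl mul1r.
  rewrite -/E; have := IH (ltnW nM); set s1 := \sum_(j < M) _; set s0 := \sum_(j < M) _.
  set s2 := \sum_(j < M) _ => a1 a2.
  rewrite (_ : s2 - s0 = (s2 - s1) + (s1 - s0)); last by ring.
  by apply: le_trans (normcD _ _) _; rewrite -natr1; lra.
have := step M (leqnn M); rewrite mulrC divfK ?gt_eqF//.
move/le_trans; apply; rewrite /E normrM normfV (gtr0_norm Mr).
rewrite le_eqVlt; apply/orP; left; apply/eqP; field; exact: lt0r_neq0.
Qed.

End VerticalShift.

(** * Discrete Fourier coefficients *)

Section DiscreteFourier.
Context {R : realType}.
Implicit Types (T x : R) (u v : R -> R[i]) (N M n j : nat) (m k : int).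

(** The integer behind [freq], so that aliasing can be expressed by divisibility. *)
Definition freqz N j : int := j%:Z - (N./2)%:Z.

Lemma freqE N j : freq N j = (freqz N j)%:~R :> R.
Proof. by rewrite /freq /freqz rmorphB. Qed.

Lemma omega_node T M x j : 0 < T -> omega T x * node T M j = 2 * pi * x * j%:R / M%:R.
Proof.
move=> T0; rewrite /omega /node.
have [->|M0] := posnP M; first by rewrite invr0 !mulr0.
by field; rewrite (gt_eqF T0) pnatr_eq0 -lt0n M0.
Qed.

(** Geometric sum of an N-th root of unity z. When N does not divide m, z <> 1 because |z - 1| = 2
    |sin (pi m / N)|, and reducing m modulo N brings the angle strictly between 0 and pi. *)
Lemma sum_expi N m : (0 < N)%N ->
  \sum_(j < N) expi (2 * pi * m%:~R * j%:R / N%:R : R) =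
  if (N %| m)%Z then N%:R else 0.
Proof.
move=> N0; have Nr : (N%:R : R) != 0 by rewrite pnatr_eq0 -lt0n.
pose z : R[i] := expi (2 * pi * m%:~R / N%:R : R).
have zE j : expi (2 * pi * m%:~R * j%:R / N%:R : R) = z ^+ j.
  by rewrite expiX mulrAC.
under eq_bigr do rewrite zE.
case: ifPn => [/dvdzP[q mE]|Nm].
  have -> : z = 1.
    rewrite /z mE (_ : _ / _ = 2 * pi * q%:~R); first exact: expi2pi_int.
    by rewrite rmorphM /=; field.
  by under eq_bigr do rewrite expr1n; rewrite sumr_const card_ord.
have zN : z ^+ N = 1 by rewrite expiX divfK// expi2pi_int.
have z1 : z - 1 != 0; last first.
  by apply: (mulfI z1); rewrite -subrX1 zN subrr mulr0.
rewrite -normc_eq0 -sqrf_eq0 normc_expiB1_sqr mulf_eq0 pnatr_eq0 /= sqrf_eq0.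
set s := sin _.
have -> : s = sin (pi * (m %/ N)%Z%:~R + pi * (m %% N)%Z%:~R / N%:R).
  congr sin; rewrite {1}(divz_eq m N) rmorphD rmorphM /=; field; exact: Nr.
rewrite sinD.
have mN0 : (m %% N)%Z != 0 by apply: contra Nm => /eqP/dvdz_mod0P.
have spi (q : int) : sin (pi * q%:~R : R) = 0.
  have sn (i : nat) : sin (pi * i%:R : R) = 0.
    elim: i => [|i IH]; first by rewrite mulr0 sin0.
    by rewrite -natr1 mulrDr mulr1 sinDpi IH oppr0.
  by case: q => i; [exact: sn|rewrite NegzE mulrNz mulrN sinN sn oppr0].
have cpi : cos (pi * (m %/ N)%Z%:~R : R) != 0.
  apply/eqP => c0; have := cos2Dsin2 (pi * (m %/ N)%Z%:~R : R).
  by rewrite c0 spi expr0n add0r => /eqP; rewrite eq_sym oner_eq0.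
rewrite spi mul0r add0r mulf_neq0// gt_eqF// sin_gt0_pi//.
have m0 : (0 < (m %% N)%Z%:~R :> R).
  by rewrite ltr0z lt_def mN0 modz_ge0// -lt0n.
have mN : ((m %% N)%Z%:~R < N%:R :> R).
  by rewrite -[N%:R]/(N%:~R) ltr_int ltz_pmod.
rewrite divr_gt0 ?mulr_gt0 ?pi_gt0 ?ltr0n//=.
by rewrite ltr_pdivrMr ?ltr0n// ltr_pM2l ?pi_gt0.
Qed.

Lemma freqz_eq N m j : (j < N)%N ->
  (N %| m - freqz N j)%Z = (j == `|((m + (N./2)%:Z) %% N)%Z|%N).
Proof.
move=> jN; have N0 : (0 < N)%N by apply: leq_ltn_trans jN.
have -> : m - freqz N j = (m + (N./2)%:Z) - j%:Z by rewrite /freqz; lia.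
rewrite -eqz_mod_dvd [X in _ == X]modz_small ?jN ?ltz_nat//.
rewrite eq_sym -eqz_nat gez0_abs// modz_ge0//.
by rewrite -lt0n.
Qed.

Lemma dft_expi T N m k : 0 < T -> (0 < N)%N ->
  dft T N (fun t => expi (omega T m%:~R * t)) k%:~R =
  ((N %| m - k)%Z)%:R.
Proof.
move=> T0 N0; rewrite /dft.
under eq_bigr => j _.
  rewrite -expiD !omega_node// -mulrBl.
  rewrite (_ : _ - _ = 2 * pi * (m - k)%:~R * j%:R); last by rewrite rmorphB /=; ring.
  over.
rewrite sum_expi//; case: ifP => _; last by rewrite mulr0.
by rewrite mulVf// -normc_eq0 normc_nat pnatr_eq0 -lt0n.
Qed.

(** Aliasing: by orthogonality only the band frequency congruent to m modulo N survives. *)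
Lemma fourier_interp_expi T N m x : 0 < T -> (0 < N)%N ->
  fourier_interp T N (fun t => expi (omega T m%:~R * t)) x =
  expi (omega T (freq N `|((m + (N./2)%:Z) %% N)%Z|%N) * x).
Proof.
move=> T0 N0; set r := `|_|%N.
have rN : (r < N)%N.
  have mN : ((m + (N./2)%:Z) %% N)%Z < N by rewrite ltz_pmod.
  have m0 : 0 <= ((m + (N./2)%:Z) %% N)%Z by rewrite modz_ge0// -lt0n.
  by rewrite -ltz_nat gez0_abs.
rewrite /fourier_interp (bigD1 (Ordinal rN))//= big1 ?addr0.
  by rewrite freqE dft_expi// freqz_eq// eqxx mul1r.
move=> i ir; rewrite freqE dft_expi// freqz_eq// -/r.
have /negbTE -> : (i : nat) != r by apply: contra ir => /eqP ir; apply/eqP/val_inj.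
by rewrite mul0r.
Qed.

Lemma dft_sum T N (I : finType) (c : I -> R[i]) (e : I -> R -> R[i]) u (k : R) :
  (forall j, (j < N)%N -> u (node T N j) = \sum_i c i * e i (node T N j)) ->
  dft T N u k = \sum_i c i * dft T N (e i) k.
Proof.
move=> uE; rewrite /dft; under eq_bigr => j _ do rewrite uE// mulr_suml.
rewrite exchange_big mulr_sumr; apply: eq_bigr => i _ /=.
rewrite [RHS]mulrCA [in RHS]mulr_sumr; congr (_ * _).
by apply: eq_bigr => j _; rewrite [RHS]mulrA.
Qed.

Lemma fourier_interp_sum T N (I : finType) (c : I -> R[i]) (e : I -> R -> R[i]) u x :
  (forall j, (j < N)%N -> u (node T N j) = \sum_i c i * e i (node T N j)) ->
  fourier_interp T N u x = \sum_i c i * fourier_interp T N (e i) x.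
Proof.
move=> uE; rewrite /fourier_interp.
under eq_bigr => j _ do rewrite (dft_sum _ uE) mulr_suml.
rewrite exchange_big; apply: eq_bigr => i _ /=; rewrite mulr_sumr.
by apply: eq_bigr => j _; rewrite mulrA.
Qed.

Lemma fourier_interp_node T M u j : 0 < T -> (j < M)%N ->
  fourier_interp T M u (node T M j) = u (node T M j).
Proof.
move=> T0 jM; have M0 : (0 < M)%N by apply: leq_ltn_trans jM.
have Mc : (M%:R : R[i]) != 0 by rewrite -normc_eq0 normc_nat pnatr_eq0 -lt0n.
have K (a b c : R[i]) : c != 0 -> a * c * (b / c) = a * b by move=> c0; field.
rewrite /fourier_interp /dft.
under eq_bigr => i _ do rewrite mulrAC mulr_sumr.
rewrite exchange_big /= (bigD1 (Ordinal jM))//= [X in _ + X]big1 ?addr0.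
  rewrite (eq_bigr (fun=> M%:R^-1 * u (node T M j))); last first.
    by move=> i _; rewrite expiN K ?expi_neq0.
  by rewrite sumr_const card_ord -[LHS]mulr_natl mulVKf.
move=> l lj.
have {}lj : (l : nat) != j by apply: contra lj => /eqP lj; apply/eqP/val_inj.
pose q : int := j%:Z - l%:Z.
(* The offset M / 2 of the frequencies contributes only a phase independent of i, leaving an
   orthogonality sum in j - l. *)
have E (i : 'I_M) : expi (- (omega T (freq M i) * node T M l)) *
    expi (omega T (freq M i) * node T M j) =
    expi (- (2 * pi * (M./2)%:R * q%:~R / M%:R : R)) * expi (2 * pi * q%:~R * i%:R / M%:R : R).
  rewrite -!expiD !omega_node//; congr expi; rewrite /freq /q rmorphB /=.
  by rewrite -![_%:~R]/(_%:R); ring.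
transitivity (\sum_(i < M) (u (node T M l) / M%:R *
   expi (- (2 * pi * (M./2)%:R * q%:~R / M%:R : R))) * expi (2 * pi * q%:~R * i%:R / M%:R : R)).
  apply: eq_bigr => i _; rewrite -[RHS]mulrA -E; ring.
rewrite -mulr_sumr sum_expi// ifF ?mulr0//; apply/negbTE.
rewrite -eqz_mod_dvd !modz_small ?ltz_nat ?jM ?ltn_ord//.
by rewrite eqz_nat eq_sym.
Qed.

Lemma interp_error_grid T N n u j : 0 < T -> (0 < N)%N -> ~~ odd N -> (j < N * n)%N ->
  normc (u (node T (N * n) j) - fourier_interp T N u (node T (N * n) j)) <=
  \sum_(l < N * n) (if (N./2 <= `|freqz (N * n) l|)%N then
     2 * normc (dft T (N * n) u (freqz (N * n) l)%:~R) else 0).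
Proof.
move=> T0 N0 Ne jM; set M := (N * n)%N in jM *.
have n0 : (0 < n)%N by move: jM; rewrite /M; case: (n) => //; rewrite muln0.
pose c (l : 'I_M) := dft T M u (freqz M l)%:~R.
pose e (l : 'I_M) (t : R) := expi (omega T (freqz M l)%:~R * t).
have uE i : (i < M)%N -> u (node T M i) = \sum_(l < M) c l * e l (node T M i).
  move=> iM; rewrite -{1}(fourier_interp_node u T0 iM) /fourier_interp.
  by apply: eq_bigr => l _; rewrite freqE.
have nodeN i : node T N i = node T M (i * n).
  rewrite /node /M !natrM; field.
  by rewrite !pnatr_eq0 -!lt0n n0 N0.
rewrite (@fourier_interp_sum _ _ _ c e); last first.
  by move=> i iN; rewrite nodeN uE// ltn_pmul2r.
rewrite uE// -sumrB; apply: le_trans (normc_sum _ _ _) _.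
apply: ler_sum => l _; rewrite -mulrBr Normc.normcM mulrC.
rewrite /e fourier_interp_expi//; case: ifPn => [_|].
  rewrite ler_wpM2r ?normc_ge0//; apply: le_trans (normcB _ _) _.
  by rewrite !normc_expi.
rewrite -ltnNge => lN.
(* A frequency k with |k| < N / 2 is its own alias: k + N / 2 is already reduced modulo N, so the
   term cancels. *)
have [m0 m1] : 0 <= freqz M l + (N./2)%:Z /\ freqz M l + (N./2)%:Z < N%:Z.
  by have := odd_double_half N; rewrite (negbTE Ne); lia.
rewrite freqE /freqz modz_small ?m0// gez0_abs// addrK.
by rewrite subrr Normc.normc0 mul0r.
Qed.

(** Both factors are M-periodic at the ends, so no boundary term appears. *)
Lemma sum_by_parts (a : nat -> R[i]) (z : R[i]) M : z != 0 -> z ^+ M = 1 -> a M = a 0%N ->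
  \sum_(j < M) (a j.+1 - a j) * z ^+ j = (z^-1 - 1) * \sum_(j < M) a j * z ^+ j.
Proof.
move=> z0 zM aM.
have E : \sum_(j < M) a j.+1 * z ^+ j.+1 = \sum_(j < M) a j * z ^+ j.
  apply: (addrI (a 0%N * z ^+ 0)).
  transitivity (\sum_(j < M.+1) a j * z ^+ j); first by rewrite big_ord_recl.
  by rewrite big_ord_recr /= zM aM expr0 addrC.
under eq_bigr do rewrite mulrBl; rewrite sumrB mulrBl mul1r -[in z^-1 * _]E mulr_sumr.
by congr (_ - _); apply: eq_bigr => j _; rewrite exprS; field.
Qed.

(** Two cyclic summations by parts multiply the sum by (exp (i t) - 1)^2, whose modulus is at least
    (|t| / 8)^2. The condition on a (M + 1) closes the cycle of first differences. *)
Lemma second_difference_decay (a : nat -> R[i]) (t D : R) M : expi (t * M%:R) = 1 ->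
  a M = a 0%N -> a M.+1 = a 1%N -> `|t| <= pi ->
  (forall j, (j < M)%N -> normc (a j.+2 - a j.+1 - (a j.+1 - a j)) <= D) ->
  t ^+ 2 / 64 * normc (\sum_(j < M) a j * expi (- t) ^+ j) <= M%:R * D.
Proof.
move=> tM aM aM1 tpi aD.
have z0 := expi_neq0 (- t).
have zM : expi (- t) ^+ M = 1 by rewrite expiX mulNr expiN tM invr1.
have e1 := sum_by_parts z0 zM aM.
have := @sum_by_parts (fun j => a j.+1 - a j) _ _ z0 zM; rewrite aM aM1 => /(_ erefl).
rewrite e1 mulrA -expr2 -expiN opprK => e2.
have : normc ((expi t - 1) ^+ 2 * \sum_(j < M) a j * expi (- t) ^+ j) <= M%:R * D.
  rewrite -e2; apply: le_trans (normc_sum _ _ _) _.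
  apply: (@le_trans _ _ (\sum_(j < M) D)); last by rewrite sumr_const card_ord -[_ *+ M]mulr_natl.
  apply: ler_sum => j _; rewrite Normc.normcM normcX normc_expi expr1n mulr1.
  exact: aD.
apply: le_trans; rewrite Normc.normcM normcX; apply: ler_wpM2r; first exact: normc_ge0.
have := normc_expiB1_ge tpi; rewrite -real_normK ?num_real//.
have := normr_ge0 t; have := normc_ge0 (expi t - 1); nra.
Qed.

(** With q = M / 2 the negative frequencies have moduli 1, ..., q and the others 0, ..., q - 1, so
    no modulus occurs more than twice. *)
Lemma sum_freqz (F : nat -> R) M : ~~ odd M -> (forall i, 0 <= F i) ->
  \sum_(l < M) F `|freqz M l|%N <= 2 * \sum_(i < M./2.+1) F i.
Proof.
move=> Me F0; have := odd_double_half M; rewrite (negbTE Me) add0n -addnn.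
set q := M./2 => Mq.
rewrite -(big_mkord xpredT (fun l => F `|freqz M l|%N)) -{1}Mq.
rewrite (@big_cat_nat _ _ _ q) ?leq_addr//= mulr_natl mulr2n; apply: lerD.
  rewrite big_nat_rev /= add0n big_mkord.
  rewrite (eq_bigr (fun i : 'I_q => F i.+1)); last first.
    move=> i _; congr F; rewrite /freqz -/q; have := ltn_ord i; lia.
  by rewrite big_ord_recl lerDr.
rewrite -{1}[q]add0n big_addn addnK big_mkord.
rewrite (eq_bigr (fun i : 'I_q => F i)); last first.
  by move=> i _; congr F; rewrite /freqz -/q; lia.
by rewrite big_ord_recr lerDl.
Qed.

End DiscreteFourier.

(** * Decay of the discrete coefficients and the pointwise error *)

Section CoefficientDecay.
Context {R : realType}.
Implicit Types (f d : R[i] -> R[i]) (T b x y A : R) (k : int) (M N : nat).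

Lemma dft_exp_decay f d T b A k : 0 < T -> 0 <= b ->
  (forall z, rect T b z -> quad f d z) ->
  (forall y, - b <= y <= b -> f (0 +i* y) = f (T +i* y)) ->
  (forall z, rect T b z -> normc (f z) <= A) ->
  exists (C : R) (M0 : nat), forall M, (M0 <= M)%N ->
  normc (dft T M (fun x => f x%:C) k%:~R) <=
    A * expR (- (omega T `|k|%N%:R * b)) + C / M%:R.
Proof.
move=> T0 b0 fQ fT fA; pose kap := omega T k%:~R.
(* At height y the factor exp (- i omega_k z) has modulus exp (omega_k y), so the side is chosen
   against the sign of k. *)
pose y := if 0 <= k then - b else b.
have yb : - b <= y <= b by rewrite /y; case: ifP => _; rewrite lexx; apply/andP; split; lra.
have kapy : kap * y = - (omega T `|k|%N%:R * b).
  rewrite /kap /y /omega; case: k {kap y yb} => i /=.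
    by rewrite -[(Posz i)%:~R]/(i%:R); ring.
  by rewrite NegzE mulrNz -[(Posz i.+1)%:~R]/(i.+1%:R); ring.
pose g z := f z * cexp kap z.
have gT t : - b <= t <= b -> g (0 +i* t) = g (T +i* t).
  move=> tb; rewrite /g fT//; congr (_ * _).
  rewrite /cexp /= mulr0 oppr0 expi0 mulr1 expiN.
  rewrite (_ : kap * T = 2 * pi * k%:~R) ?expi2pi_int ?invr1 ?mulr1//.
  by rewrite /kap /omega; field; rewrite gt_eqF.
have [C [M0 H]] := sum_vertical_shift T0 (fun z zr => quadM (fQ z zr) (quad_cexp kap z)) gT yb.
exists C, (maxn M0 1) => M; rewrite geq_max => /andP[/H{}H M1].
have Mr : 0 < M%:R :> R by rewrite ltr0n.
have Mc : (M%:R : R[i]) != 0 by rewrite -normc_eq0 normc_nat gt_eqF.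
have -> : dft T M (fun x => f x%:C) k%:~R = M%:R^-1 * \sum_(j < M) g (node T M j +i* 0).
  rewrite /dft; congr (_ * _); apply: eq_bigr => j _.
  by rewrite /g /= [_ +i* 0]complexr0 cexp_real.
rewrite Normc.normcM Normc.normcV normc_nat mulrC ler_pdivrMr// mulrDl divfK ?gt_eqF//.
have h : normc (\sum_(j < M) g (node T M j +i* y)) <=
    A * expR (- (omega T `|k|%N%:R * b)) * M%:R.
  apply: le_trans (normc_sum _ _ _) _.
  apply: (@le_trans _ _ (\sum_(j < M) A * expR (- (omega T `|k|%N%:R * b)))).
    apply: ler_sum => j _; rewrite Normc.normcM normc_cexp /= kapy.
    apply: ler_wpM2r; first exact: expR_ge0.
    by apply: fA; split => //=; apply: node_itv; rewrite ?(ltW T0) ?(ltnW (ltn_ord j)).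
  by rewrite sumr_const card_ord -[_ *+ M]mulr_natr.
rewrite -[X in normc X](subKr (\sum_(j < M) g (node T M j +i* y))).
by apply: le_trans (normcB _ _) _; apply: lerD.
Qed.

(** The second differences of the samples are at most 2 B (T / M)^2, and 2 |k| <= M keeps the angle
    s = 2 pi k / M within [- pi, pi]. Then s^2 / 64 times the sum is at most 2 M B (T / M)^2, and
    128 / (4 pi^2) <= 32 gives the constant. *)
Lemma dft_sqr_decay f d T b : 0 < T -> 0 <= b ->
  (forall z, rect T b z -> quad f d z) -> f 0 = f T%:C -> d 0 = d T%:C ->
  exists (C : R) (M0 : nat), 0 <= C /\ forall M k, (M0 <= M)%N -> k != 0 ->
  (`|k| * 2 <= M)%N -> normc (dft T M (fun x => f x%:C) k%:~R) <= C / (`|k|%N%:R) ^+ 2.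
Proof.
move=> T0 b0 /quad_uniform[rho [B [rho0 U]]] fT dT.
have m0 : 0 <= T / rho by rewrite divr_ge0 ?ltW.
have B0 : 0 <= B.
  have [||+ _ _] := U 0 0.
  - by split => /=; apply/andP; split; lra.
  - by rewrite subrr Normc.normc0.
  - by apply: le_trans; exact: normc_ge0.
exists (32 * B * T ^+ 2), (maxn 2 (Num.bound (T / rho))).
split; first by rewrite mulr_ge0 ?sqr_ge0// mulr_ge0.
move=> M k; rewrite geq_max => /andP[M2 MM] k0 kM.
have Mrho : T / rho < M%:R.
  by apply: lt_le_trans (archi_boundP m0) _; rewrite ler_nat.
have Mr : 0 < M%:R :> R by apply: le_lt_trans m0 Mrho.
have Mn : (0 < M)%N by rewrite -(ltr0n R).
pose t := T / M%:R; have t0 : 0 < t by rewrite divr_gt0.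
have trho : t < rho by rewrite ltr_pdivrMr// mulrC -ltr_pdivrMr.
pose F j := f (node T M j)%:C.
have F1 j : (j < M)%N -> normc (F j.+1 - F j - d (node T M j)%:C * t%:C) <= B * t ^+ 2.
  move=> jM; have E : (node T M j.+1)%:C - (node T M j)%:C = t%:C.
    by rewrite nodeS rmorphD /= addrC addKr.
  have := U (node T M j)%:C (node T M j.+1)%:C.
  rewrite E normc_real gtr0_norm// => H.
  by have [|//|//] := H; split; rewrite /= ?oppr_le0 ?b0// node_itv ?(ltW T0) ?(ltnW jM).
have F2 j : (j < M)%N -> normc (F j - F j.+1 + d (node T M j.+1)%:C * t%:C) <= B * t ^+ 2.
  move=> jM; have E : (node T M j)%:C - (node T M j.+1)%:C = - t%:C.
    by rewrite nodeS rmorphD /= opprD addrA subrr sub0r.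
  have := U (node T M j.+1)%:C (node T M j)%:C.
  rewrite E normcN normc_real gtr0_norm// mulrN opprK => H.
  by have [|//|//] := H; split; rewrite /= ?oppr_le0 ?b0// node_itv ?(ltW T0).
(* The samples are extended periodically, so that the second difference at j = M - 1 wraps around to
   the first nodes. *)
pose a j := F (j %% M)%N.
have FM : F M = F 0%N by rewrite /F nodeT// node0 fT.
have a_small j : (j <= M)%N -> a j = F j.
  by rewrite leq_eqVlt => /predU1P[->|jM]; rewrite /a ?modnn ?FM// modn_small.
have aM1 : a M.+1 = a 1%N by rewrite /a -addn1 modnDl.
have aM : a M = a 0%N by rewrite /a modnn mod0n.
pose s : R := 2 * pi * k%:~R / M%:R.
have sM : expi (s * M%:R) = 1 by rewrite divfK ?gt_eqF// expi2pi_int.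
have kabs : `|k%:~R : R| = `|k|%N%:R by rewrite -intr_norm -abszE.
have kn0 : 0 < `|k|%N%:R :> R by rewrite ltr0n absz_gt0.
have p0 := @pi_gt0 R.
have sabs : `|s| = 2 * pi * `|k|%N%:R / M%:R.
  by rewrite /s !normrM normfV kabs !gtr0_norm.
have spi : `|s| <= pi.
  have kM' : `|k|%N%:R * 2 <= M%:R :> R by rewrite -natrM ler_nat.
  by rewrite sabs ler_pdivrMr//; have := ler_wpM2l (ltW p0) kM'; lra.
have aD j : (j < M)%N -> normc (a j.+2 - a j.+1 - (a j.+1 - a j)) <= 2 * (B * t ^+ 2).
  move=> jM; have [j2|j2] := ltnP j.+1 M.
    rewrite !a_small ?(ltnW jM) ?(ltnW j2) ?jM// (_ : _ - _ = (F j.+2 - F j.+1 - d (node T M j.+1)%:C * t%:C) +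
      (F j - F j.+1 + d (node T M j.+1)%:C * t%:C)); last by ring.
    by apply: le_trans (normcD _ _) _; have := F1 _ j2; have := F2 _ jM; lra.
  (* At the seam, the backward expansion at T and the forward one at 0 fit together because [f] and
     [d] agree at 0 and T. *)
  have -> : j.+1 = M by apply/eqP; rewrite eqn_leq jM.
  have jE : j.+1 = M by apply/eqP; rewrite eqn_leq jM.
  rewrite aM1 aM !a_small ?(ltnW jM) ?(ltnW M2)//.
  rewrite (_ : _ - _ = (F 1%N - F 0%N - d (node T M 0)%:C * t%:C) +
      (F j - F j.+1 + d (node T M j.+1)%:C * t%:C)); last first.
    by rewrite jE FM nodeT// node0 -dT; ring.
  by apply: le_trans (normcD _ _) _; have := F1 _ Mn; have := F2 _ jM; lra.
have := second_difference_decay sM aM aM1 spi aD.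
have -> : dft T M (fun x => f x%:C) k%:~R = M%:R^-1 * \sum_(j < M) a j * expi (- s) ^+ j.
  rewrite /dft; congr (_ * _); apply: eq_bigr => j _.
  rewrite a_small ?(ltnW (ltn_ord j))// expiX omega_node// /F; congr (_ * expi _).
  by rewrite /s; ring.
set X := \sum_(j < M) _ => HX.
rewrite Normc.normcM Normc.normcV normc_nat mulrC ler_pdivrMr//.
rewrite mulrAC ler_pdivlMr ?exprn_gt0//.
have s2 : s ^+ 2 = 4 * pi ^+ 2 * (`|k|%N%:R) ^+ 2 / M%:R ^+ 2.
  by rewrite -real_normK ?num_real// sabs; field; rewrite gt_eqF.
rewrite s2 /t in HX.
have HX' : 4 * pi ^+ 2 * (normc X * `|k|%N%:R ^+ 2) <= 128 * B * T ^+ 2 * M%:R.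
  have M64 : 0 <= 64 * M%:R ^+ 2 :> R by rewrite mulr_ge0// sqr_ge0.
  have := ler_wpM2r M64 HX.
  rewrite (_ : 4 * pi ^+ 2 * _ / _ / 64 * _ * _ = 4 * pi ^+ 2 * (normc X * `|k|%N%:R ^+ 2)); last first.
    by field; rewrite gt_eqF.
  move/le_trans; apply; rewrite le_eqVlt; apply/orP; left; apply/eqP.
  by field; rewrite gt_eqF.
have pi1 : 1 <= pi :> R by have := pihalf_ge1 R; lra.
have pi2 : 1 <= pi ^+ 2 :> R by rewrite expr2; nra.
have Y0 : 0 <= normc X * `|k|%N%:R ^+ 2 by rewrite mulr_ge0 ?normc_ge0 ?sqr_ge0.
nra.
Qed.

(** For p >= 1, 1 / p^2 <= 2 / p - 2 / (p + 1), and the right-hand side telescopes. *)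
Lemma sum_inv_sqr K n : (0 < K)%N ->
  \sum_(K <= i < K + n) (i%:R ^+ 2)^-1 <= 2 / K%:R - 2 / (K + n)%:R :> R.
Proof.
move=> K0; elim: n => [|n IH]; first by rewrite addn0 big_geq// subrr.
rewrite addnS big_nat_recr ?leq_addr//=; apply: le_trans (lerD IH (lexx _)) _.
have p1 : 1 <= (K + n)%:R :> R by rewrite ler1n (leq_trans K0) ?leq_addr.
rewrite -[(K + n).+1%:R]natr1; set p := (K + n)%:R in p1 *.
have p0 : 0 < p by lra.
have Kr : 0 < K%:R :> R by rewrite ltr0n.
rewrite -subr_ge0 (_ : _ - _ = (p - 1) / (p ^+ 2 * (p + 1))); last first.
  by field; rewrite !gt_eqF//; lra.
by rewrite divr_ge0 ?subr_ge0// mulr_ge0 ?sqr_ge0//; lra.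
Qed.

Lemma normc_expiB_le x y : normc (expi x - expi y) <= `|x - y|.
Proof.
rewrite (_ : expi x - expi y = expi y * (expi (x - y) - 1)); last first.
  by rewrite mulrBr mulr1 -expiD subrKC.
rewrite Normc.normcM normc_expi mul1r -(@ler_pXn2r _ 2) ?nnegrE ?normc_ge0//.
rewrite normc_expiB1_sqr.
have := norm_sin_le ((x - y) / 2); rewrite normrM [`|2^-1|]gtr0_norm ?invr_gt0// => h.
rewrite -[sin _ ^+ 2]real_normK ?num_real//.
have := normr_ge0 (sin ((x - y) / 2)); have := normr_ge0 (x - y); nra.
Qed.

Lemma fourier_interp_lipschitz T N (u : R -> R[i]) : exists2 B : R, 0 <= B &
  forall x y, normc (fourier_interp T N u x - fourier_interp T N u y) <= B * `|x - y|.
Proof.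
exists (\sum_(i < N) normc (dft T N u (freq N i)) * `|omega T (freq N i)|).
  by rewrite sumr_ge0// => i _; rewrite mulr_ge0 ?normc_ge0.
move=> x y; rewrite /fourier_interp -sumrB; apply: le_trans (normc_sum _ _ _) _.
rewrite mulr_suml; apply: ler_sum => i _; rewrite -mulrBr Normc.normcM -[leRHS]mulrA.
apply: ler_wpM2l; first exact: normc_ge0.
apply: le_trans (normc_expiB_le _ _) _.
by rewrite -mulrBr normrM.
Qed.

Lemma node_near T x M : 0 < T -> 0 <= x <= T -> (0 < M)%N ->
  exists2 j, (j < M)%N & `|x - node T M j| <= T / M%:R.
Proof.
move=> T0 /andP[x0 xT] M0; have Mr : 0 < M%:R :> R by rewrite ltr0n.
have y0 : 0 <= x * M%:R / T by rewrite divr_ge0 ?mulr_ge0 ?(ltW T0).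
have /andP[j1 j2] := truncn_itv y0; set j := Num.truncn _ in j1 j2.
have H (i : nat) : i%:R <= x * M%:R / T <= i.+1%:R -> `|x - node T M i| <= T / M%:R.
  rewrite ler_pdivlMr// ler_pdivrMr// => /andP[h1 h2].
  have h1' : node T M i <= x by rewrite /node ler_pdivrMr// mulrC.
  have h2' : x <= node T M i + T / M%:R.
    by rewrite /node -mulrDl ler_pdivlMr// -[X in _ + X]mulr1 -mulrDr natr1 mulrC [T * _]mulrC mulrC.
  by rewrite ger0_norm; lra.
have [jM|jM] := ltnP j M; first by exists j => //; apply: H; rewrite j1 ltW.
(* Only x = T leads here; the last node is then at distance T / M. *)
exists M.-1; first by rewrite prednK.
apply: H; rewrite prednK//; apply/andP; split.
  by apply: le_trans j1; rewrite ler_nat (leq_trans (leq_pred _)).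
by rewrite ler_pdivrMr// mulrC ler_pM2l.
Qed.

Lemma uniform_threshold (P : nat -> int -> Prop) (K : nat) :
  (forall k, exists M0, forall M, (M0 <= M)%N -> P M k) ->
  exists M0, forall M k, (M0 <= M)%N -> (`|k| < K)%N -> P M k.
Proof.
move=> H; elim: K => [|K [M0 IH]]; first by exists 0%N.
have [M1 H1] := H K%:Z; have [M2 H2] := H (- K%:Z).
exists (maxn M0 (maxn M1 M2)) => M k; rewrite !geq_max => /and3P[a0 a1 a2].
rewrite ltnS leq_eqVlt => /predU1P[kK|]; last exact: IH.
have [->|->] : k = K%:Z \/ k = - K%:Z by lia.
  exact: H1.
exact: H2.
Qed.

Lemma freqz_le M (l : nat) : ~~ odd M -> (l < M)%N -> (`|freqz M l| * 2 <= M)%N.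
Proof.
by move=> Me lM; have := odd_double_half M; rewrite (negbTE Me) /freqz; lia.
Qed.

(** Dominated convergence by hand: the bound [L] is used below a cut-off K and C / k^2 above it, on
    a grid fine enough to carry the estimate from a node to x. In 4 S, one factor 2 comes from a
    frequency and its alias, the other from the two signs of k. *)
Lemma interp_error_le T N (u : R -> R[i]) (L : nat -> R) (S C : R) (M0 : nat) :
  0 < T -> (0 < N)%N -> ~~ odd N -> 0 <= C -> (forall i, 0 <= L i) ->
  (forall M k, (M0 <= M)%N -> k != 0 -> (`|k| * 2 <= M)%N ->
    normc (dft T M u k%:~R) <= C / (`|k|%N%:R) ^+ 2) ->
  (forall k e, 0 < e -> exists M1, forall M, (M1 <= M)%N ->
    normc (dft T M u k%:~R) <= L `|k|%N + e) ->
  (forall K, \sum_(i < K | (N./2 <= i)%N) L i <= S) ->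
  (forall e, 0 < e -> exists2 dl, 0 < dl & forall x y, 0 <= x <= T -> 0 <= y <= T ->
    `|x - y| < dl -> normc (u x - u y) <= e) ->
  forall x, 0 <= x <= T -> normc (u x - fourier_interp T N u x) <= 4 * S.
Proof.
move=> T0 N0 Ne C0 L0 HC HL HS Hu x xT; apply/ler_addgt0Pr => e' e'0.
(* 14 = 2 (2 + 4) + 1 + 1: twice the errors 2 e below the cut-off and 4 e above it, and one e each
   for moving [u] and its interpolant between x and a node. *)
pose e := e' / 14; have e0 : 0 < e by rewrite divr_gt0.
have N20 : (0 < N./2)%N by have := odd_double_half N; rewrite (negbTE Ne); lia.
have Ce0 : 0 <= C / e by rewrite divr_ge0 ?(ltW e0).
pose K := (Num.bound (C / e)).+1.
have K0 : 0 < K%:R :> R by rewrite ltr0n.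
have CK : C / K%:R <= e.
  rewrite ler_pdivrMr// mulrC -ler_pdivrMr//; apply: le_trans (ltW (archi_boundP Ce0)) _.
  by rewrite ler_nat.
have eK0 : 0 < e / K%:R by rewrite divr_gt0.
have [M1 HM1] := @uniform_threshold (fun M k => normc (dft T M u k%:~R) <= L `|k|%N + e / K%:R) K
  (fun k => HL k _ eK0).
have [dl dl0 Hdl] := Hu e e0.
have [B B0 HB] := fourier_interp_lipschitz T N u.
have Tdl : 0 <= T / dl by rewrite divr_ge0 ?(ltW dl0) ?(ltW T0).
have BTe : 0 <= B * T / e by apply: divr_ge0 (ltW e0); apply: mulr_ge0 (ltW T0).
have q0 : 0 <= T / dl + B * T / e by rewrite addr_ge0.
(* The term T / dl brings the mesh below the modulus of continuity of [u]; B T / e does so for the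
   Lipschitz bound of the interpolant. *)
pose n := maxn (maxn M0 M1) (Num.bound (T / dl + B * T / e)).
have n0 : (0 < n)%N by rewrite -(ltr0n R) (le_lt_trans q0)// (lt_le_trans (archi_boundP q0))// ler_nat leq_maxr.
pose M := (N * n)%N; have nM : (n <= M)%N by rewrite leq_pmull.
have M0n : (M0 <= M)%N by rewrite (leq_trans _ nM)// !leq_max leqnn.
have M1n : (M1 <= M)%N by rewrite (leq_trans _ nM)// !leq_max leqnn orbT.
have Mn : (0 < M)%N by exact: leq_trans nM.
have Mr : 0 < M%:R :> R by rewrite ltr0n.
have qM : T / dl + B * T / e < M%:R.
  by apply: lt_le_trans (archi_boundP q0) _; rewrite ler_nat (leq_trans _ nM)// leq_maxr.
have TM1 : T / M%:R < dl.
  by rewrite ltr_pdivrMr// mulrC -ltr_pdivrMr// (le_lt_trans _ qM)// lerDl.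
have TM2 : B * (T / M%:R) <= e.
  by rewrite mulrA ler_pdivrMr// [e * _]mulrC -ler_pdivrMr// (le_trans _ (ltW qM))// lerDr.
have [j jM jx] := node_near T0 xT Mn.
(* Majorant of the contribution to the error of a frequency with |k| = i. The share e / K adds up to
   e over the K indices below the cut-off. *)
pose F i := if (i < N./2)%N then 0 else if (i < K)%N then 2 * (L i + e / K%:R)
  else 2 * (C / i%:R ^+ 2).
have F0 i : 0 <= F i.
  rewrite /F; case: ifP => // _; case: ifP => _; rewrite mulr_ge0//.
    by rewrite addr_ge0// ltW.
  by rewrite divr_ge0// sqr_ge0.
have Me : ~~ odd M by rewrite oddM negb_and Ne.
have grid : normc (u (node T M j) - fourier_interp T N u (node T M j)) <=
    2 * \sum_(i < M./2.+1) F i.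
  apply: le_trans (interp_error_grid u T0 N0 Ne jM) _.
  apply: le_trans (sum_freqz Me F0); apply: ler_sum => l _; rewrite /F ltnNge.
  case: (boolP (N./2 <= _)%N) => //= lN; case: ifP => lK; rewrite ler_pM2l//.
    exact: HM1.
  apply: HC => //; first by rewrite -absz_gt0 (leq_trans N20).
  exact: freqz_le.
have FK : \sum_(i < M./2.+1) F i <= 2 * S + 2 * e + 4 * e.
  apply: (@le_trans _ _ (\sum_(0 <= i < K + M./2.+1) F i)).
    rewrite -(big_mkord xpredT F) [leRHS](@big_cat_nat _ _ _ M./2.+1) ?leq_addl//=.
    by rewrite lerDl sumr_ge0.
  rewrite (@big_cat_nat _ _ _ K) ?leq_addr//=; apply: lerD.
    rewrite big_mkord.
    apply: (@le_trans _ _ (\sum_(i < K) ((if (N./2 <= i)%N then 2 * L i else 0) + 2 * (e / K%:R)))).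
      apply: ler_sum => i _; rewrite /F ltn_ord; case: leqP => _ /=; first by rewrite mulrDr.
      by rewrite add0r mulr_ge0// ltW.
    rewrite big_split /= -big_mkcond /= -mulr_sumr lerD//; first by rewrite ler_pM2l// HS.
    by rewrite sumr_const card_ord -[_ *+ K]mulr_natr -mulrA divfK// gt_eqF.
  apply: (@le_trans _ _ (\sum_(K <= i < K + M./2.+1) 2 * C * (i%:R ^+ 2)^-1)).
    rewrite !big_nat; apply: ler_sum => i /andP[Ki _]; rewrite /F [(i < K)%N]ltnNge Ki /=.
    case: ifP => _; last by rewrite mulrA.
    by rewrite !mulr_ge0 ?invr_ge0 ?sqr_ge0.
  rewrite -mulr_sumr.
  have h0 : 0 <= 2 / (K + M./2.+1)%:R :> R by rewrite divr_ge0.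
  have h1 := sum_inv_sqr M./2.+1 (ltn0Sn _ : 0 < K)%N.
  have h2 : \sum_(K <= i < K + M./2.+1) (i%:R ^+ 2)^-1 <= 2 / K%:R :> R by lra.
  have := ler_wpM2l C0 h2; lra.
have xn := node_itv (ltW T0) (ltnW jM).
have u1 : normc (u x - u (node T M j)) <= e by apply: Hdl => //; exact: le_lt_trans TM1.
have u2 : normc (fourier_interp T N u (node T M j) - fourier_interp T N u x) <= e.
  by apply: le_trans (HB _ _) _; apply: le_trans TM2; rewrite distrC ler_wpM2l.
rewrite (_ : u x - _ = (u x - u (node T M j)) + ((u (node T M j) - fourier_interp T N u (node T M j)) +
  (fourier_interp T N u (node T M j) - fourier_interp T N u x))); last by ring.
apply: le_trans (normcD _ _) _.
have := normcD (u (node T M j) - fourier_interp T N u (node T M j))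
  (fourier_interp T N u (node T M j) - fourier_interp T N u x).
have -> : e' = 14 * e by rewrite /e; field.
lra.
Qed.

End CoefficientDecay.

(** * Norms *)

Section Norms.
Context {R : realType}.
Implicit Types (f d : R[i] -> R[i]) (T b A B : R) (v : R -> R[i]).

(** Uniform continuity supplies the measurability of the integrand, which is compared with the
    constant B^2 on [0, T]. *)
Lemma L2norm_le T v B : 0 < T -> 0 <= B ->
  (forall e, 0 < e -> exists2 dl, 0 < dl & forall x y, 0 <= x <= T -> 0 <= y <= T ->
    `|x - y| < dl -> normc (v x - v y) <= e) ->
  (forall x, 0 <= x <= T -> normc (v x) <= B) ->
  (L2norm T v <= (B * Num.sqrt T)%:E)%E.
Proof.
move=> T0 B0 cv vB.
have cn : {within `[0, T], continuous (fun x => normc (v x) ^+ 2)}.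
  suff cn : {within `[0, T], continuous (fun x => normc (v x))}.
    by rewrite (_ : (fun _ => _) = (fun x => normc (v x) * normc (v x)));
      [exact: within_continuousM|apply/funext => x; rewrite expr2].
  apply/subspace_continuousP => x xT; apply/cvgrPdist_lt => e e0.
  have [|dl dl0 H] := cv (e / 2); first by rewrite divr_gt0.
  rewrite /prop_near1 /within /=; apply/nbhs_ballP; exists dl => //= y yx yT.
  have {}H : normc (v x - v y) < e.
    apply: (@le_lt_trans _ _ (e / 2)); last by rewrite ltr_pdivrMr//; lra.
    by apply: H => //; move: xT yT; rewrite /= !in_itv.
  apply: le_lt_trans H; rewrite ler_norml; apply/andP; split.
    rewrite lerNl opprB lerBlDr; have := normcD (v y - v x) (v x).
    by rewrite subrK normc_distC.
  by rewrite lerBlDr; have := normcD (v x - v y) (v y); rewrite subrK.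
rewrite /L2norm unlock /=.
have -> : (\int[lebesgue_measure]_x
      (`|((fun x0 : R => normc (v x0)) \_ `[0%R, T] x)%:E| `^ 2) =
    \int[lebesgue_measure]_(x in `[0%R, T]) (normc (v x) ^+ 2)%:E)%E.
  rewrite [RHS]integral_mkcond; apply: eq_integral => x _.
  rewrite /= /patch /=; case: ifP => _.
    by rewrite ger0_norm ?normc_ge0// -powR_mulrn ?normc_ge0.
  by rewrite normr0 powR0.
have le1 : (\int[lebesgue_measure]_(x in `[0%R, T]) (normc (v x) ^+ 2)%:E <=
    (B ^+ 2 * T)%:E)%E.
  apply: (@le_trans _ _ (\int[lebesgue_measure]_(x in `[0%R, T]) (cst (B ^+ 2)%:E x))%E).
    apply: ge0_le_integral => //.
    - by move=> x _; rewrite lee_fin sqr_ge0.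
    - exact: measurable_int (within_continuous_integrable cn).
    move=> x; rewrite /= in_itv /= => /vB xB; rewrite lee_fin.
    by rewrite lerXn2r// ?nnegrE ?normc_ge0.
  by rewrite integral_cst//= lebesgue_measure_itv /= lte_fin T0 -EFinB subr0 EFinM.
have int0 : (0 <= \int[lebesgue_measure]_(x in `[0%R, T]) (normc (v x) ^+ 2)%:E)%E.
  by apply: integral_ge0 => x _; rewrite lee_fin sqr_ge0.
have -> : (B * Num.sqrt T)%:E = ((B ^+ 2 * T)%:E `^ 2^-1)%E.
  rewrite poweR_EFin powR12_sqrt; last by rewrite mulr_ge0 ?sqr_ge0// ltW.
  by rewrite sqrtrM ?sqr_ge0// sqrtr_sqr ger0_norm.
apply: gt0_ler_poweR => //; rewrite ?in_itv /= ?int0 ?leey//.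
by rewrite andbT lee_fin mulr_ge0 ?sqr_ge0// ltW.
Qed.

(** As z may lie on the boundary, the square extends from z towards the middle of the rectangle in
    each coordinate. *)
Lemma rect_square T b z r : 0 < T -> 0 < b -> 0 < r -> rect T b z ->
  exists x y m : R, 0 < m /\ forall s t, x <= s <= x + m -> y <= t <= y + m ->
    rect T b (s +i* t) /\ normc ((s +i* t) - z) < r.
Proof.
move=> T0 b0 r0; case: z => zx zy [/= /andP[zx0 zxT] /andP[zy0 zyb]].
pose m := Num.min (r / 3) (Num.min (T / 2) b).
have m0 : 0 < m by rewrite !lt_min b0 !divr_gt0.
have mr : m <= r / 3 by rewrite ge_min lexx.
have mT : m <= T / 2 by rewrite !ge_min lexx orbT.
have mb : m <= b by rewrite !ge_min lexx !orbT.
pose x := if zx <= T / 2 then zx else zx - m.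
pose y := if zy <= 0 then zy else zy - m.
exists x, y, m; split => // s t /andP[s1 s2] /andP[t1 t2].
have [x1 x2 x3] : [/\ 0 <= x, x + m <= T & zx - m <= x <= zx].
  by rewrite /x; case: (leP zx (T / 2)) => ?; split; try lra; apply/andP; split; lra.
have [y1 y2 y3] : [/\ - b <= y, y + m <= b & zy - m <= y <= zy].
  by rewrite /y; case: (leP zy 0) => ?; split; try lra; apply/andP; split; lra.
move: x3 y3 => /andP[x3 x4] /andP[y3 y4].
split; first by split; apply/andP; split => /=; lra.
apply: (le_lt_trans (normc_le_ReIm ((s +i* t) - (zx +i* zy)))) => /=.
have : `|s - zx| <= m by rewrite ler_norml; apply/andP; split; lra.
have : `|t - zy| <= m by rewrite ler_norml; apply/andP; split; lra.
lra.
Qed.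

Lemma quad_continuous f d z : quad f d z -> forall e, 0 < e ->
  exists2 dl, 0 < dl & forall w, normc (w - z) < dl -> normc (f w - f z) < e.
Proof.
move=> [r [B [r0 Q]]] e e0; pose D := `|B| + 1.
have D0 : 0 < D by rewrite ltr_wpDl.
have BD : B <= D by have := ler_norm B; rewrite /D; lra.
exists (Num.min r (Num.min 1 (e / (2 * D)))).
  by rewrite !lt_min r0 ltr01 divr_gt0// mulr_gt0.
move=> w; rewrite !lt_min => /and3P[wr w1]; rewrite ltr_pdivlMr ?mulr_gt0// => we.
have := Q z w; rewrite subrr Normc.normc0 => /(_ r0 wr)[_ dB].
set h := w - z in w1 we *; have h0 := normc_ge0 h => fB.
rewrite (_ : f w - f z = (f w - f z - d z * h) + d z * h); last by ring.
apply: le_lt_trans (normcD _ _) _; rewrite Normc.normcM.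
have a1 : B * normc h ^+ 2 <= D * normc h.
  apply: (@le_trans _ _ (D * normc h ^+ 2)); first by rewrite ler_wpM2r ?sqr_ge0.
  by rewrite ler_pM2l// expr2 ler_piMl// ltW.
have a2 : normc (d z) * normc h <= D * normc h by rewrite ler_wpM2r// (le_trans dB).
lra.
Qed.

(* By continuity a value exceeding the essential supremum would be exceeded on a
   square of positive measure inside the rectangle. *)
Lemma normA_ge f d T b A : 0 < T -> 0 < b ->
  (forall z, rect T b z -> quad f d z) -> (normA T b f <= A%:E)%E ->
  forall z, rect T b z -> normc (f z) <= A.
Proof.
move=> T0 b0 fQ nA z zr; rewrite leNgt; apply/negP => fzA.
have [|dl dl0 fc] := quad_continuous (fQ z zr) (e := normc (f z) - A).
  by rewrite subr_gt0.
have [x [y [m [m0 sq]]]] := rect_square T0 b0 dl0 zr.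
pose mu := (@lebesgue_measure R \x @lebesgue_measure R)%E.
pose Q : set (R * R) := `[x, x + m]%classic `*` `[y, y + m]%classic.
have muQ : (0 < mu Q)%E.
  rewrite /mu /Q product_measure1E//= !lebesgue_measure_itv /= !lte_fin !ltrDl m0.
  by rewrite -!EFinB -EFinM lte_fin !(addrC _ m) !addrK mulr_gt0.
have mQ : measurable Q by exact: measurableX.
have fQA p : Q p -> A < normc (f (p.1 +i* p.2)).
  case: p => s t [/=]; rewrite !in_itv /= => sx ty.
  have [_ /fc] := sq s t sx ty; rewrite normc_distC => h.
  by have := normcD (f z - f (s +i* t)) (f (s +i* t)); rewrite subrK; lra.
(* The norm of exponent infinity is an essential supremum once the whole space has positive measure,
   which [Q] guarantees. *)
move: nA; rewrite /normA unlock /= -/mu ifT; last first.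
  by apply: (lt_le_trans muQ); apply: le_measure; rewrite ?inE.
set v := (X in ess_sup _ (abse \o (EFin \o X))) => nA.
have [N [mN N0 HN]] := ess_sup_ge mu (abse \o (EFin \o v)).
have QN : Q `<=` N.
  move=> p pQ; apply: HN => /=; apply/negP; rewrite -ltNge.
  apply: le_lt_trans nA _; rewrite lte_fin /v /patch ifT.
    by rewrite ger0_norm ?normc_ge0//; exact: fQA.
  rewrite inE /=; case: p pQ => s t [/=]; rewrite !in_itv /= => sx ty.
  by have [] := sq s t sx ty.
have : (mu Q <= mu N)%E by apply: le_measure; rewrite ?inE.
by rewrite {2}/mu N0 leNgt muQ.
Qed.

End Norms.

(** * The mean-square error and the two conclusions *)

Section Interpolation.
Context {R : realType}.
Implicit Types (f d : R[i] -> R[i]) (T b A q : R) (N : nat).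

Lemma geometric_tail q m K : 0 <= q < 1 ->
  \sum_(i < K | (m <= i)%N) q ^+ i <= q ^+ m / (1 - q).
Proof.
move=> /andP[q0 q1]; rewrite ler_pdivlMr ?subr_gt0//.
(* Using [maxn m K] covers K <= m, where the sum is empty. *)
suff : (\sum_(i < K | (m <= i)%N) q ^+ i) * (1 - q) + q ^+ maxn m K = q ^+ m.
  by move=> <-; rewrite lerDl exprn_ge0.
elim: K => [|K IH]; first by rewrite big_ord0 mul0r add0r maxn0.
rewrite big_mkcond big_ord_recr /= -big_mkcond /=.
have [mK|Km] := leqP m K.
  by rewrite -IH (maxn_idPr mK) (maxn_idPr (leqW mK)) exprS; ring.
by rewrite addr0 -[RHS]IH (maxn_idPl Km) (maxn_idPl (ltnW Km)).
Qed.

(** The limiting bound [L] on the coefficients stays abstract, because the two conclusions use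
    different ones: a geometric sequence, and a sequence vanishing off 0. *)
Lemma interp_L2norm_le f T b N (L : nat -> R) (S : R) :
  0 < T -> 0 < b -> spaceA T b f -> (0 < N)%N -> ~~ odd N ->
  (forall i, 0 <= L i) ->
  (forall (k : int) e, 0 < e -> exists M1, forall M, (M1 <= M)%N ->
    normc (dft T M (fun x => f x%:C) k%:~R) <= L `|k|%N + e) ->
  (forall K, \sum_(i < K | (N./2 <= i)%N) L i <= S) ->
  (L2norm T (fun x => f x%:C - fourier_interp T N (fun x => f x%:C) x)%R <=
    (4 * S * Num.sqrt T)%:E)%E.
Proof.
move=> T0 b0 [Sf fan] N0 Ne L0 HL HS.
have fQ z : rect T b z -> quad f (cderiv f) z.
  by move=> zr; have [a fa] := analytic_near_has_ps fan zr; exact: has_ps_quad fa.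
have Hu e : 0 < e -> exists2 dl, 0 < dl & forall x y, 0 <= x <= T -> 0 <= y <= T ->
    `|x - y| < dl -> normc (f x%:C - f y%:C) <= e.
  have [rho [B [rho0 U]]] := quad_uniform fQ.
  move=> e0; pose D := `|B| + 1; have D0 : 0 < D by rewrite ltr_wpDl.
  exists (Num.min rho (Num.min 1 (e / (2 * D)))).
    by rewrite !lt_min rho0 ltr01 divr_gt0// mulr_gt0.
  move=> x y xT yT; rewrite !lt_min => /and3P[h1 h2]; rewrite ltr_pdivlMr ?mulr_gt0// => h3.
  have yr : rect T b y%:C by apply: real_rect; rewrite ?in_itv ?(ltW b0).
  have E : x%:C - y%:C = (x - y)%:C by rewrite rmorphB.
  have := U y%:C x%:C yr; rewrite E normc_real => /(_ h1)[_ d1].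
  set h := `|x - y| in h2 h3 * => d2; have h0 : 0 <= h by exact: normr_ge0.
  rewrite (_ : f x%:C - f y%:C = (f x%:C - f y%:C - cderiv f y%:C * (x - y)%:C) +
    cderiv f y%:C * (x - y)%:C); last by ring.
  apply: le_trans (normcD _ _) _; rewrite Normc.normcM normc_real -/h.
  have BD : B <= D by have := ler_norm B; rewrite /D; lra.
  have a1 : B * h ^+ 2 <= D * h.
    apply: (@le_trans _ _ (D * h ^+ 2)); first by rewrite ler_wpM2r ?sqr_ge0.
    by rewrite ler_pM2l// expr2 ler_piMl// ltW.
  have a2 : normc (cderiv f y%:C) * h <= D * h by rewrite ler_wpM2r// (le_trans d1).
  lra.
have fTT := spaceA_periodic T0 (ltW b0) fan Sf.
have f0T : f 0 = f T%:C by have := fTT 0; apply; rewrite oppr_le0 ltW.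
have d0T : cderiv f 0 = cderiv f T%:C.
  exact: (spaceA_iter_periodic 1 T0 (ltW b0) fan Sf).
have [C [M0 [C0 HC]]] := dft_sqr_decay T0 (ltW b0) fQ f0T d0T.
have S0 : 0 <= S by have := HS 0%N; rewrite big_ord0.
have [B B0 HB] := fourier_interp_lipschitz T N (fun x => f x%:C).
apply: L2norm_le => //; first by rewrite mulr_ge0.
  move=> e e0; have e20 : 0 < e / 2 by rewrite divr_gt0.
  have [dl dl0 Hdl] := Hu _ e20.
  have B1 : 0 < B + 1 by rewrite ltr_wpDl.
  exists (Num.min dl (e / 2 / (B + 1))); first by rewrite lt_min dl0 divr_gt0.
  move=> x y xT yT; rewrite lt_min => /andP[h1]; rewrite ltr_pdivlMr// => h2.
  set gx := fourier_interp _ _ _ x; set gy := fourier_interp _ _ _ y.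
  rewrite (_ : f x%:C - gx - (f y%:C - gy) = (f x%:C - f y%:C) - (gx - gy)); last by ring.
  apply: le_trans (normcB _ _) _.
  have := Hdl x y xT yT h1; have := HB x y; rewrite -/gx -/gy.
  have := normr_ge0 (x - y).
  lra.
exact: interp_error_le T0 N0 Ne C0 L0 HC HL HS Hu.
Qed.

End Interpolation.

Theorem corollary5p1 (R : realType) (T beta : R) (f : R[i] -> R[i])
    (T_gt0 : 0 < T) (beta_gt0 : 0 < beta) (fA : spaceA T beta f) :
  let u := fun x : R => f x%:C in
  let err := fun N : nat => L2norm T (fun x => u x - fourier_interp T N u x) in
  (exists C : R, \forall N \near \oo, ~~ odd N ->
     (err N <= (C * expR (- omega T (N%:R * beta / 2)))%:E)%E) /\
  (beta_analytic T beta f ->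
     forall N : nat, (0 < N)%N -> ~~ odd N -> err N = 0%E).
Proof.
move=> u err.
have [Sf fan] := fA.
have quadf b z : analytic_near f (rect T b) -> rect T b z -> quad f (cderiv f) z.
  by move=> fb zr; have [a fa] := analytic_near_has_ps fb zr; exact: has_ps_quad fa.
have [rho [A [rho0 U]]] := quad_uniform (fun z => quadf beta z fan).
have fA' z : rect T beta z -> normc (f z) <= A.
  by move=> zr; have [|//] := U z z zr; rewrite subrr Normc.normc0.
have A0 : 0 <= A.
  apply: le_trans (normc_ge0 (f 0%:C)) _; apply: fA'.
  by apply: real_rect; rewrite ?in_itv /= ?lexx ltW.
have decay (k : int) e : 0 < e -> exists M1, forall M, (M1 <= M)%N ->
    normc (dft T M u k%:~R) <= A * expR (- (omega T `|k|%N%:R * beta)) + e.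
  move=> e0; have [C [M0 H]] := dft_exp_decay k T_gt0 (ltW beta_gt0)
    (fun z => quadf beta z fan) (spaceA_periodic T_gt0 (ltW beta_gt0) fan Sf) fA'.
  have Ce0 : 0 <= `|C| / e by rewrite divr_ge0 ?(ltW e0).
  exists (maxn M0 (Num.bound (`|C| / e))) => M; rewrite geq_max => /andP[/H{}H MC].
  apply: le_trans H _; rewrite lerD2l.
  have MC' : `|C| / e < M%:R by apply: lt_le_trans (archi_boundP Ce0) _; rewrite ler_nat.
  have M0' : 0 < M%:R :> R by exact: le_lt_trans Ce0 MC'.
  rewrite ler_pdivrMr// (le_trans (ler_norm C))// mulrC -ler_pdivrMr//; exact: ltW.
split.
  (* Since omega is linear in its index, exp (- omega_i beta) = q^i, and the tail is geometric. *)
  pose q := expR (- (omega T 1 * beta)).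
  have om i : omega T i%:R * beta = i%:R * (omega T 1 * beta) by rewrite /omega; ring.
  have qi i : expR (- (omega T i%:R * beta)) = q ^+ i.
    by rewrite om -mulrN mulrC expRM_natr.
  have q1 : 0 <= q < 1.
    rewrite expR_ge0 /= expR_lt1 oppr_lt0 mulr_gt0// /omega mulr1.
    by rewrite divr_gt0// mulr_gt0// pi_gt0.
  (* The error is at most 4 A q^(N/2) / (1 - q) pointwise, sqrt T comes from the length of [0, T],
     and q^(N/2) is the required exponential. *)
  exists (4 * (A / (1 - q)) * Num.sqrt T); exists 1%N => //= N N0 Ne.
  have -> : expR (- omega T (N%:R * beta / 2)) = q ^+ N./2.
    rewrite -qi; congr expR; congr (- _).
    have := odd_double_half N; rewrite (negbTE Ne) add0n -muln2 => {1}<-.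
    by rewrite natrM /omega; field; rewrite gt_eqF.
  pose S := A * (q ^+ N./2 / (1 - q)).
  rewrite (_ : _ * q ^+ _ = 4 * S * Num.sqrt T); last by rewrite /S; ring.
  apply: (@interp_L2norm_le _ f T beta N (fun i => A * q ^+ i)) => //.
  - by move=> i; rewrite mulr_ge0// exprn_ge0//; case/andP: q1.
  - by move=> k e /(decay k)[M1 H]; exists M1 => M /H; rewrite qi.
  - by move=> K; rewrite -mulr_sumr ler_wpM2l// geometric_tail.
move=> [_ fstrip fnorm] N N0 Ne.
have fanb b : analytic_near f (rect T b).
  have [V [oV KV Vf]] := fstrip; exists V; split => // z [zr _]; exact: KV.
apply/eqP; rewrite eq_le Lnorm_ge0 andbT.
(* The majorant vanishes off frequency 0, which lies inside the band because N / 2 >= 1; hence the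
   tail bound S = 0. *)
have := @interp_L2norm_le _ f T beta N (fun i => if i == 0%N then A else 0) 0 T_gt0 beta_gt0
  fA N0 Ne.
rewrite mulr0 mul0r; apply.
- by move=> i; case: ifP.
- move=> k e e0; have [k0|k0] := eqVneq k 0.
    have [M1 H] := decay k e e0; exists M1 => M /H; rewrite k0 /= /omega !(mulr0, mul0r).
    by rewrite oppr0 expR0 mulr1.
  rewrite absz_eq0 (negbTE k0) add0r.
  have e20 : 0 < e / 2 by rewrite divr_gt0.
  have small : nbhs (0%E : \bar R) [set x | (x < (e / 2)%:E)%E].
    change (nbhs (0 : R) (fun r : R => (r%:E < (e / 2)%:E)%E)).
    apply/nbhs_ballP; exists (e / 2) => //= x; rewrite /ball /= sub0r normrN => xe.
    by rewrite lte_fin (le_lt_trans (ler_norm x)).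
  have [b0 [_ Hb]] := fnorm _ small.
  (* A positive height beyond the threshold of the limit: on its rectangle |f| <= (e / 2) exp
     (omega_b). *)
  pose b := Num.max b0 0 + 1.
  have bb0 : b0 < b by rewrite /b ltr_pwDr// le_max lexx.
  have b_gt0 : 0 < b by rewrite /b ltr_wpDl// le_max lexx orbT.
  have := Hb b bb0; rewrite /= inver gt_eqF ?expR_gt0// lte_pdivrMr ?expR_gt0// => /ltW nb.
  have fb := normA_ge T_gt0 b_gt0 (fun z => quadf b z (fanb b)) nb.
  have [C [M0 H]] := dft_exp_decay k T_gt0 (ltW b_gt0)
    (fun z => quadf b z (fanb b)) (spaceA_periodic T_gt0 (ltW b_gt0) (fanb b) Sf) fb.
  have Ce0 : 0 <= `|C| / (e / 2) by rewrite divr_ge0 ?(ltW e20).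
  exists (maxn M0 (Num.bound (`|C| / (e / 2)))) => M; rewrite geq_max => /andP[/H{}H MC].
  have MC' : `|C| / (e / 2) < M%:R by apply: lt_le_trans (archi_boundP Ce0) _; rewrite ler_nat.
  have M0' : 0 < M%:R :> R by exact: le_lt_trans Ce0 MC'.
  have CM : C / M%:R <= e / 2.
    by rewrite ler_pdivrMr// (le_trans (ler_norm C))// mulrC -ler_pdivrMr//; exact: ltW.
  apply: le_trans H _; rewrite [leRHS]splitr lerD//.
  (* As k <> 0, omega_|k| b = |k| omega_b >= omega_b, so the decay absorbs the growth exp (omega_b)
     and e / 2 remains. *)
  rewrite -mulrA -expRD ler_piMr ?(ltW e20)// -[leRHS]expR0 ler_expR subr_le0.
  rewrite (_ : omega T _ * b = omega T b * `|k|%N%:R); last by rewrite /omega; ring.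
  rewrite ler_peMr ?ler1n ?absz_gt0//.
  by apply: divr_ge0 (ltW T_gt0); rewrite !mulr_ge0 ?pi_ge0 ?(ltW b_gt0).
move=> K; rewrite big1// => i Ni; rewrite ifN// -lt0n (leq_trans _ Ni)//.
by have := odd_double_half N; rewrite (negbTE Ne); lia.
Qed.
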